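(* Let $\gamma\in[0,2]$, let $\mathcal{O}\subset\mathbb{R}^d$ be a bounded domain and let $c,h_1,h_2\in C(\overline{\mathcal{O}})$. Let $F:\mathbb{R}\to\mathbb{R}$ be continuous and strictly increasing. Let $H:\overline{\mathcal{O}}\times\mathbb{R}^d\to\mathbb{R}$ be a continuous function such that for some $\beta\in(0,3-\gamma]$ and some constant $C$, $$H(x,p)\le C(1+|p|^\beta)\quad\text{for all }(x,p)\in\overline{\mathcal{O}}\times\mathbb{R}^d,$$ and $$|H(x,p)-H(y,p)|\le\omega(|x-y|)(1+|p|^\beta)\quad\text{for all }x,y\in\overline{\mathcal{O}},\ p\in\mathbb{R}^d,$$ where $\omega:[0,\infty)\to[0,\infty)$ is a continuous function with $\omega(0)=0$. Suppose that $u$ is a bounded, upper-semicontinuous function on $\overline{\mathcal{O}}$ which is a viscosity subsolution of $$\Delta_\infty^\gamma u+H(x,\nabla u)+c(x)F(u(x))=h_1(x)\quad\text{in }\mathcal{O},$$ and that $v$ is a bounded, lower-semicontinuous function on $\overline{\mathcal{O}}$ which is a viscosity supersolution of $$\Delta_\infty^\gamma v+H(x,\nabla v)+c(x)F(v(x))=h_2(x)\quad\text{in }\mathcal{O}.$$ Furthermore, assume that $v\ge u$ on $\partial\mathcal{O}$ and that one of the following holds: (a) $c<0$ in $\overline{\mathcal{O}}$ and $h_1\ge h_2$ in $\overline{\mathcal{O}}$; (b) $c\le0$ in $\overline{\mathcal{O}}$ and $h_1>h_2$ in $\overline{\mathcal{O}}$. Then $v\ge u$ in $\overline{\mathcal{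O}}$.
   Context: For a $C^2$ function $\varphi$, $\Delta_\infty^\gamma\varphi=|\nabla\varphi|^{-\gamma}\sum_{i,j=1}^d\partial_{x_i}\varphi\,\partial_{x_ix_j}\varphi\,\partial_{x_j}\varphi$. Viscosity sense: consider an equation $\Delta_\infty^\gamma u+G(x,u,\nabla u)=0$ in an open set $U\subset\mathbb{R}^d$ with $G$ continuous. An upper-semicontinuous $u$ is a subsolution (satisfies the inequality $\ge0$) if, whenever $x_0\in U$ and $\varphi$ is $C^2$ near $x_0$ with $u(x_0)=\varphi(x_0)$ and $u<\varphi$ in a punctured ball around $x_0$, one has $\Delta_\infty^\gamma\varphi(x_0)+G(x_0,u(x_0),\nabla\varphi(x_0))\ge0$; if $\nabla\varphi(x_0)=0$, the term $\Delta_\infty^\gamma\varphi(x_0)$ is read as $0$ when $\gamma<2$ and as $M(D^2\varphi(x_0))=\max_{|\xi|=1}\langle\xi,D^2\varphi(x_0)\xi\rangle$ when $\gamma=2$. A lower-semicontinuous $u$ is a supersolution (satisfies $\le0$) if, whenever $\varphi$ is $C^2$ near $x_0$ with $u(x_0)=\varphi(x_0)$ and $u>\varphi$ in a punctured ball around $x_0$, one has $\Delta_\infty^\gamma\varphi(x_0)+G(x_0,u(x_0),\nabla\varphi(x_0))\le0$; if $\nabla\varphi(x_0)=0$, $\Delta_\infty^\gamma\varphi(x_0)$ is read as $0$ when $\gamma<2$ and as $m(D^2\varphi(x_0))=\min_{|\xi|=1}\langle\xi,D^2\varphi(x_0)\xi\rangle$ when $\gamma=2$. *)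

(* Defs.v *)
From HB Require Import structures.
From mathcomp Require Import all_boot all_order all_algebra.
From mathcomp Require Import all_classical all_reals all_analysis.
Set Implicit Arguments.
Unset Strict Implicit.
Unset Printing Implicit Defensive.
Import Order.TTheory GRing.Theory Num.Theory.
Import numFieldNormedType.Exports.
Local Open Scope classical_set_scope.
Local Open Scope ring_scope.

Section defs.
Context {R : realType} {d : nat}.
Implicit Types (x p xi : 'rV[R]_d) (A : 'M[R]_d) (O U : set 'rV[R]_d).
Implicit Types (u v phi : 'rV[R]_d -> R) (G : 'rV[R]_d -> R -> 'rV[R]_d -> R).

(* The library norm `|x| on 'rV[R]_d is the sup norm; |x| in the mathematical
   text is the Euclidean one. Both induce the topology of 'rV[R]_d. *)
Definition enorm x : R := Num.sqrt (\sum_(i < d) x 0 i ^+ 2).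

Definition domain O := [/\ open O, connected O & O !=set0].

Definition boundary O : set 'rV[R]_d := closure O `\` interior O.

(* In [subspace U] the points outside U are isolated, so semicontinuity there
   is vacuous and only the relative topology of U matters. *)
Definition lsc_on U v :=
  lower_semicontinuous (fun x : subspace U => (v x)%:E).

Definition usc_on U u := lsc_on U (fun x => - u x).

Definition basis_vec (i : 'I_d) : 'rV[R]_d := delta_mx 0 i.

Definition partial (i : 'I_d) phi : 'rV[R]_d -> R := 'D_(basis_vec i) phi.

Definition grad phi x : 'rV[R]_d := \row_i partial i phi x.

Definition hess phi x : 'M[R]_d := \matrix_(i, j) partial j (partial i phi) x.

Definition C2_near x phi := \forall y \near x,
  [/\ {for y, continuous phi},
      forall i, derivable phi y (basis_vec i) /\
                {for y, continuous (partial i phi)}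
    & forall i j, derivable (partial i phi) y (basis_vec j) /\
                  {for y, continuous (partial j (partial i phi))}].

Definition qform A xi : R := \sum_(i < d) \sum_(j < d) xi 0 i * A i j * xi 0 j.

(* For d > 0 the unit sphere is nonempty and compact, so this supremum and this
   infimum are attained: they are the max and min over |xi| = 1. *)
Definition maxform A : R := sup [set qform A xi | xi in [set xi | enorm xi = 1]].
Definition minform A : R := inf [set qform A xi | xi in [set xi | enorm xi = 1]].

Definition inf_laplacian (gamma : R) phi x : R :=
  enorm (grad phi x) `^ (- gamma) * qform (hess phi x) (grad phi x).

Definition inf_laplacian_sub (gamma : R) phi x : R :=
  if grad phi x == 0 then (if gamma < 2 then 0 else maxform (hess phi x))
  else inf_laplacian gamma phi x.

Definition inf_laplacian_super (gamma : R) phi x : R :=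
  if grad phi x == 0 then (if gamma < 2 then 0 else minform (hess phi x))
  else inf_laplacian gamma phi x.

(* Viscosity sub/supersolutions in U of
   Delta_infty^gamma u + G (x, u, grad u) = 0. *)
Definition viscosity_subsolution (gamma : R) G U u :=
  usc_on U u /\
  forall x0 phi, U x0 -> C2_near x0 phi -> u x0 = phi x0 ->
    (\forall x \near x0^', u x < phi x) ->
    0 <= inf_laplacian_sub gamma phi x0 + G x0 (u x0) (grad phi x0).

Definition viscosity_supersolution (gamma : R) G U v :=
  lsc_on U v /\
  forall x0 phi, U x0 -> C2_near x0 phi -> v x0 = phi x0 ->
    (\forall x \near x0^', phi x < v x) ->
    inf_laplacian_super gamma phi x0 + G x0 (v x0) (grad phi x0) <= 0.

End defs.

(* Main.v *)
Require Import Defs.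
From HB Require Import structures.
From mathcomp Require Import all_boot all_order all_algebra.
From mathcomp Require Import all_classical all_reals all_analysis.
From mathcomp Require Import ring lra.
Set Implicit Arguments.
Unset Strict Implicit.
Unset Printing Implicit Defensive.
Import Order.TTheory GRing.Theory Num.Theory.
Import numFieldNormedType.Exports.
Local Open Scope classical_set_scope.
Local Open Scope ring_scope.

(* Suppose u > v somewhere and maximise u x - v y - k |x - y|^4. The subsolution u
   is Lipschitz near the maximum point, by comparison with the radial barrier
   A r - B r^2 (this uses H <= C (1 + |p|^beta) with beta <= 3 - gamma), so the
   gradient p of the penalty stays bounded as k grows and the modulus of H
   beats the term |H x p - H y p|.
   No theorem on sums is needed. If p = 0, i.e. x = y, the penalty itself is a test
   function with vanishing Hessian. If p != 0, only the second difference in the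
   direction e of p matters: in a thin box around x, comparison with quadratic
   polynomials bounds from below the sum of the suprema of
   u (x + w) - u x - p . w over two small discs around w = s e and w = - s e, and
   similarly for - v at y. Maximality bounds the total of the four suprema from
   above by a constant times the squared thickness of the box, a contradiction. *)

(** The contradiction is scalar. If the two lower-order parts have a negative sum, there are
    curvatures [a1], [a2] with [a1 + a2 > 0] such that second derivatives [a1] and [a2] along [e]
    still strictly violate the two inequalities. This forces the second differences over a length
    [s] to add up to at least [(a1 + a2) * s ^+ 2]. But the penalty is invariant under a common
    translation of both points, so only the transversal spread [(eta * s) ^+ 2] is left to pay for
    them. The box must have positive thickness, because contact along a line alone is no contact in
    an open set. Its price is a transversal curvature of order [eta ^- 2], which the operator does
    not see when the gradient is parallel to [e]; the nearby gradients at the contact point are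
    handled by continuity away from 0. The growth bound on [H] is one-sided, so the barrier acts on
    [u] only; comparing the maximum with the pair [(y, y)] then suffices. The Lipschitz constant
    does not depend on [k], so the threshold for [omega] comes first and a single large [k] is fixed
    afterwards: no limit in [k] is taken. *)

Section Euclid.
Context {R : realType} {d : nat}.
Implicit Types (x y z p : 'rV[R]_d) (a : R) (K : set 'rV[R]_d).

(** * Euclidean geometry and its agreement with the sup-norm topology *)

Definition dot x y : R := \sum_(i < d) x 0 i * y 0 i.

Lemma dotC x y : dot x y = dot y x.
Proof. by apply: eq_bigr => i _; rewrite mulrC. Qed.

Lemma dotDl x y z : dot (x + y) z = dot x z + dot y z.
Proof. by rewrite -big_split; apply: eq_bigr => i _; rewrite mxE mulrDl. Qed.

Lemma dotZl a x y : dot (a *: x) y = a * dot x y.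
Proof. by rewrite mulr_sumr; apply: eq_bigr => i _; rewrite mxE mulrA. Qed.

Lemma dotNl x y : dot (- x) y = - dot x y.
Proof. by rewrite -scaleN1r dotZl mulN1r. Qed.

Lemma dotDr x y z : dot z (x + y) = dot z x + dot z y.
Proof. by rewrite dotC dotDl !(dotC _ z). Qed.

Lemma dotZr a x y : dot y (a *: x) = a * dot y x.
Proof. by rewrite dotC dotZl (dotC _ y). Qed.

Lemma dotNr x y : dot y (- x) = - dot y x.
Proof. by rewrite dotC dotNl (dotC _ y). Qed.

Definition dotE := (dotDl, dotDr, dotNl, dotNr, dotZl, dotZr).

Lemma dot0l x : dot 0 x = 0.
Proof. by rewrite -(scale0r 0) dotZl mul0r. Qed.

Lemma dot_ge0 x : 0 <= dot x x.
Proof. by apply: sumr_ge0 => i _; rewrite -expr2 sqr_ge0. Qed.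

Lemma dot_eq0 x : dot x x = 0 -> x = 0.
Proof.
move=> /eqP; rewrite psumr_eq0 => [/allP h|i _]; last by rewrite -expr2 sqr_ge0.
apply/rowP => i; have /= := h i (mem_index_enum i).
by rewrite mulf_eq0 orbb mxE => /eqP.
Qed.

Lemma CauchySchwarz_dot x y : dot x y ^+ 2 <= dot x x * dot y y.
Proof.
have [y0|y0] := eqVneq (dot y y) 0.
  by rewrite (dot_eq0 y0) dotC !dot0l expr0n mulr0.
have yy : 0 < dot y y by rewrite lt_neqAle eq_sym y0 dot_ge0.
have := dot_ge0 (dot y y *: x - dot x y *: y).
have -> : dot (dot y y *: x - dot x y *: y) (dot y y *: x - dot x y *: y) =
   dot y y * (dot x x * dot y y - dot x y ^+ 2).
  by rewrite !dotE (dotC y x); ring.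
by rewrite pmulr_rge0 // subr_ge0.
Qed.

Lemma enorm_ge0 x : 0 <= enorm x. Proof. exact: sqrtr_ge0. Qed.

Lemma enorm_sqr x : enorm x ^+ 2 = dot x x.
Proof. by rewrite sqr_sqrtr ?sumr_ge0// => i _; rewrite sqr_ge0. Qed.

Lemma enorm_eq0 x : (enorm x == 0) = (x == 0).
Proof.
rewrite -sqrf_eq0 enorm_sqr; apply/eqP/eqP => [/dot_eq0//|->].
by rewrite dot0l.
Qed.

Lemma enorm0 : enorm (0 : 'rV[R]_d) = 0.
Proof. by apply/eqP; rewrite enorm_eq0. Qed.

Lemma enorm_gt0 x : (0 < enorm x) = (x != 0).
Proof. by rewrite lt_neqAle eq_sym enorm_eq0 enorm_ge0 andbT. Qed.

Lemma ler_enorm x a : 0 <= a -> (enorm x <= a) = (dot x x <= a ^+ 2).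
Proof. by move=> a0; rewrite -enorm_sqr ler_sqr// nnegrE ?enorm_ge0. Qed.

Lemma dot_le x y : `|dot x y| <= enorm x * enorm y.
Proof.
rewrite -ler_sqr ?nnegrE ?mulr_ge0 ?enorm_ge0// exprMn !enorm_sqr.
by rewrite real_normK ?num_real// CauchySchwarz_dot.
Qed.

Lemma enormD x y : enorm (x + y) <= enorm x + enorm y.
Proof.
rewrite ler_enorm ?addr_ge0 ?enorm_ge0// !dotE (dotC y x) -!enorm_sqr.
by have := le_trans (ler_norm _) (dot_le x y); nra.
Qed.

Lemma enormZ a x : enorm (a *: x) = `|a| * enorm x.
Proof.
apply/eqP; rewrite -(@eqrXn2 _ 2)// ?mulr_ge0 ?enorm_ge0//.
by rewrite exprMn !enorm_sqr !dotE real_normK ?num_real// mulrA.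
Qed.

Lemma enormN x : enorm (- x) = enorm x.
Proof. by rewrite -scaleN1r enormZ normrN1 mul1r. Qed.

Lemma enormBC x y : enorm (x - y) = enorm (y - x).
Proof. by rewrite -enormN opprB. Qed.

Lemma coord_le_enorm x i : `|x 0 i| <= enorm x.
Proof.
rewrite -ler_sqr ?nnegrE ?enorm_ge0// enorm_sqr real_normK ?num_real//.
rewrite /dot (bigD1 i)//= -expr2 lerDl sumr_ge0// => j _.
by rewrite -expr2 sqr_ge0.
Qed.

Lemma norm_le_enorm x : `|x| <= enorm x.
Proof.
rewrite [leLHS]/Num.Def.normr/= mx_normrE; apply/bigmax_leP; split => /=.
  exact: enorm_ge0.
by move=> [i j] _ /=; rewrite ord1 coord_le_enorm.
Qed.

Lemma enorm_le_norm x : enorm x <= d%:R * `|x|.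
Proof.
have x0 := normr_ge0 x; have d0 : 0 <= d%:R :> R by [].
have h i : `|x 0 i| <= `|x|.
  by rewrite [leRHS]/Num.Def.normr/= mx_normrE; apply: (le_bigmax _ _ (0, i)).
rewrite ler_enorm ?mulr_ge0//.
apply: (@le_trans _ _ (\sum_(i < d) `|x| ^+ 2)).
  apply: ler_sum => i _; rewrite -expr2 -[leLHS]real_normK ?num_real//.
  by rewrite ler_sqr ?nnegrE.
rewrite sumr_const card_ord exprMn -[leLHS]mulr_natl ler_wpM2r ?sqr_ge0//.
by rewrite -natrX ler_nat; case: (d) => // n; rewrite expnS leq_pmulr.
Qed.

Lemma near_enormP x (P : set 'rV[R]_d) :
  (\forall y \near x, P y) <->
  exists2 r, 0 < r & forall y, enorm (y - x) < r -> P y.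
Proof.
split => [/nbhs_ballP[r /= r0 h]|[r r0 h]].
  exists r => // y yr; apply: h; rewrite -ball_normE /ball_ /= distrC.
  exact: le_lt_trans (norm_le_enorm _) yr.
(* [d.+1] instead of [d] keeps the radius positive when [d = 0]. *)
apply/nbhs_ballP; exists (r / d.+1%:R); first by rewrite /= divr_gt0.
move=> y; rewrite -ball_normE /ball_ /= distrC => yr; apply: h.
apply: le_lt_trans (enorm_le_norm _) _; apply: (@le_lt_trans _ _ (d.+1%:R * `|y - x|)).
  by rewrite ler_wpM2r// ler_nat.
by rewrite mulrC -ltr_pdivlMr.
Qed.

Lemma within_continuous_enorm K (f : 'rV[R]_d -> R) :
  {within K, continuous f} -> forall x, K x -> forall e, 0 < e ->
  exists2 r, 0 < r &
    forall y, K y -> enorm (y - x) < r -> `|f y - f x| < e.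
Proof.
move=> /subspace_continuousP cf x Kx e e0.
have /cvgrPdist_lt/(_ _ e0) := cf _ Kx; rewrite /within/=.
move=> /near_enormP[r r0 h]; exists r => // y Ky yx.
by rewrite distrC; apply: h.
Qed.

Lemma usc_on_enorm K (f : 'rV[R]_d -> R) :
  usc_on K f -> forall x, K x -> forall e, 0 < e ->
  exists2 r, 0 < r & forall y, K y -> enorm (y - x) < r -> f y < f x + e.
Proof.
move=> uf x Kx e e0.
have /= [|V] := uf x (- f x - e).
  by rewrite lte_fin ltrBlDr ltrDl.
rewrite /nbhs/= -(nbhs_subspace_in Kx) => /near_enormP[r r0 h] hV.
exists r => // y Ky yx; have := hV y (h y yx Ky).
by rewrite lte_fin; lra.
Qed.

End Euclid.

(** If the supremum were not attained, every point would have a neighbourhood on which [f] stays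
    below [sup - e] for all small [e]; compactness makes [e] uniform, which contradicts the
    supremum. The same covering argument, with a bound tending to infinity, first shows that [f] is
    bounded above. *)
Lemma compact_usc_max {R : realType} {T : topologicalType} (K : set T)
    (f : T -> R) : compact K -> K !=set0 ->
  (forall x, K x -> forall e, 0 < e -> \forall y \near x, K y -> f y < f x + e) ->
  exists2 x, K x & forall y, K y -> f y <= f x.
Proof.
move=> /compact_near_coveringP/near_covering_withinP cK [k0 Kk0] uf.
have [M hM] : exists M, forall x, K x -> f x < M.
  have : \forall M \near +oo, K `<=` (fun x => f x < M).
    apply: cK => x Kx; near=> y M => /= Ky.
    have /lt_trans : f y < f x + 1 by move: Ky; near: y; exact: uf.
    by apply; near: M; apply: nbhs_pinfty_gt; exact: num_real.
  by move=> /filter_ex[M h]; exists M.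
have hS : has_sup (f @` K).
  by split; [exists (f k0), k0|exists M => _ [x Kx <-]; exact/ltW/hM].
apply: contrapT => hn.
have lt x : K x -> f x < sup (f @` K).
  move=> Kx; rewrite lt_neqAle (ub_le_sup hS.2) ?andbT; last by exists x.
  apply/eqP => fx; apply: hn; exists x => // y Ky; rewrite fx.
  by apply: (ub_le_sup hS.2); exists y.
have : \forall e \near 0^'+, K `<=` (fun x => f x < sup (f @` K) - e).
  apply: cK => x Kx.
  have e0 : 0 < (sup (f @` K) - f x) / 2 by rewrite divr_gt0// subr_gt0 lt.
  near=> y e => /= Ky.
  have : f y < f x + (sup (f @` K) - f x) / 2 by move: Ky; near: y; exact: uf.
  have : e < (sup (f @` K) - f x) / 2 by near: e; exact: nbhs_right_lt.
  lra.
move=> h; have /filter_ex[e [/= e0 he]] :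
    \forall e \near 0^'+, 0 < e /\ K `<=` (fun x => f x < sup (f @` K) - e).
  by near=> e; split; [|near: e].
have /(sup_adherent e0)[_ [x Kx <-]] := hS.
by have := he x Kx; lra.
Unshelve. all: by end_near. Qed.

(** * Quadratic test functions and the reduction of both viscosity notions to them *)

Section Quadratic.
Context {R : realType} {d : nat}.
Implicit Types (x y v b e : 'rV[R]_d) (c al be : R) (U : set 'rV[R]_d).

(** Gradient [b] at [x0] and Hessian [al I + be e e^T]: a single rank-one term supplies all the
    anisotropy that the argument needs. *)
Definition quad c al be b e x0 x : R :=
  c + dot b (x - x0) + al / 2 * dot (x - x0) (x - x0) +
  be / 2 * dot e (x - x0) ^+ 2.

(** For [h != 0] the difference quotient is exactly [l + h * m]. Both [quad] and its partial
    derivatives have this form along every line. *)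
Lemma is_derive_poly2 (f : 'rV[R]_d -> R) y v (l m : R) :
  (forall h : R, f (h *: v + y) = f y + h * l + h ^+ 2 * m) -> is_derive y v f l.
Proof.
move=> hf.
have cv : h^-1 *: ((f \o shift y) (h *: v) - f y) @[h --> 0^'] --> l.
  have : l + h * m @[h --> (0 : R)^'] --> l + 0 * m.
    apply: cvgD; first exact: cvg_cst.
    by apply: cvgMl; apply: cvg_within.
  rewrite mul0r addr0; apply: cvg_trans; apply: near_eq_cvg.
  near=> h; rewrite /= hf /GRing.scale/=.
  have h0 : h != 0 by near: h; exact: nbhs_dnbhs_neq.
  by field.
by split; [apply/cvg_ex; exists l|apply: cvg_lim].
Unshelve. all: by end_near. Qed.

(** The common shape of [quad], its partial derivatives, the radial barrier and the doubling
    penalty. *)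
Lemma continuous_quadratic (T : topologicalType) c al be (f g h : T -> R) :
  continuous f -> continuous g -> continuous h ->
  continuous (fun t : T => c + f t + al * g t + be * h t ^+ 2).
Proof.
move=> cf cg ch t; apply: cvgD; [apply: cvgD; [apply: cvgD|]|].
- exact: cvg_cst.
- exact: cf.
- by apply: cvgMr; exact: cg.
- by apply: cvgMr; rewrite expr2; apply: cvgM; exact: ch.
Qed.

Lemma continuous_dot (T : topologicalType) (f g : T -> 'rV[R]_d) :
  (forall i, continuous (fun t : T => f t 0 i)) ->
  (forall i, continuous (fun t : T => g t 0 i)) ->
  continuous (fun t : T => dot (f t) (g t)).
Proof.
move=> cf cg t; rewrite /dot; apply: cvg_big => [|i _].
  exact: add_continuous.
by apply: cvgM; [exact: cf|exact: cg].
Qed.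

Lemma continuous_coord_sub x0 i : continuous (fun x : 'rV[R]_d => (x - x0) 0 i).
Proof.
rewrite (_ : (fun _ => _) = (fun x : 'rV[R]_d => x 0 i) - cst (x0 0 i)); last first.
  by apply/funext => x; rewrite !mxE.
by move=> x; apply: continuousB; [exact: coord_continuous|exact: cst_continuous].
Qed.

Lemma continuous_dot_sub b x0 : continuous (fun x => dot b (x - x0)).
Proof.
by apply: continuous_dot => i; [exact: cst_continuous|exact: continuous_coord_sub].
Qed.

Lemma continuous_quad c al be b e x0 : continuous (quad c al be b e x0).
Proof.
have cd := continuous_dot_sub; apply: continuous_quadratic; [exact: cd| |exact: cd].
by apply: continuous_dot; exact: continuous_coord_sub.
Qed.

Lemma dot_basis x i : dot x (basis_vec i) = x 0 i.
Proof.
rewrite /dot (bigD1 i)//= mxE !eqxx mulr1 big1 ?addr0// => j /negPf ji.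
by rewrite mxE ji andbF mulr0.
Qed.

Lemma is_derive_quad c al be b e x0 i y :
  is_derive y (basis_vec i) (quad c al be b e x0)
    (b 0 i + al * (y - x0) 0 i + be * dot e (y - x0) * e 0 i).
Proof.
apply: (is_derive_poly2 (m := al / 2 * dot (basis_vec i) (basis_vec i) +
   be / 2 * e 0 i ^+ 2)) => h.
have -> : quad c al be b e x0 (h *: basis_vec i + y) =
    quad c al be b e 0 (h *: basis_vec i + (y - x0)).
  by rewrite /quad subr0 addrA.
rewrite /quad subr0; move: (y - x0) => z.
by rewrite !dotE (dotC (basis_vec i) z) !dot_basis; field.
Qed.

Lemma partial_quad c al be b e x0 i :
  partial i (quad c al be b e x0) =
  (fun y => b 0 i + al * (y - x0) 0 i + be * dot e (y - x0) * e 0 i).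
Proof. by apply/funext => y; have [_] := is_derive_quad c al be b e x0 i y. Qed.

Lemma is_derive_partial_quad c al be b e x0 i j y :
  is_derive y (basis_vec j) (partial i (quad c al be b e x0))
    (al * (i == j)%:R + be * e 0 i * e 0 j).
Proof.
rewrite partial_quad; apply: (is_derive_poly2 (m := 0)) => h.
rewrite -!(addrA (h *: _)); move: (y - x0) => z.
by rewrite !dotE !dot_basis !mxE eqxx /=; ring.
Qed.

Lemma partial2_quad c al be b e x0 i j :
  partial j (partial i (quad c al be b e x0)) =
  (fun y => al * (i == j)%:R + be * e 0 i * e 0 j).
Proof.
by apply/funext => y; have [_] := is_derive_partial_quad c al be b e x0 i j y.
Qed.

Lemma C2_near_quad c al be b e x0 x : C2_near x (quad c al be b e x0).
Proof.
apply/near_enormP; exists 1 => // y _; split=> [|i|i j]; first exact: continuous_quad.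
  split; first by have [] := is_derive_quad c al be b e x0 i y.
  rewrite partial_quad (_ : (fun _ => _) = fun y => b 0 i + dot (al *: basis_vec i)
      (y - x0) + (be * e 0 i) * dot e (y - x0) + 0 * (0 : R) ^+ 2); last first.
    by apply/funext => z; rewrite dotZl (dotC (basis_vec i)) dot_basis; ring.
  apply: continuous_quadratic; try exact: continuous_dot_sub.
  exact: cst_continuous.
split; first by have [] := is_derive_partial_quad c al be b e x0 i j y.
by rewrite partial2_quad; exact: cst_continuous.
Qed.

Lemma grad_quad c al be b e x0 : grad (quad c al be b e x0) x0 = b.
Proof.
apply/rowP => i; rewrite mxE partial_quad subrr mxE mulr0 addr0.
by rewrite dotC dot0l mulr0 mul0r addr0.
Qed.

Lemma qform_hess_quad c al be b e x0 x xi :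
  qform (hess (quad c al be b e x0) x) xi = al * dot xi xi + be * dot e xi ^+ 2.
Proof.
rewrite /qform expr2 [X in be * (X * _)]/dot [X in _ + be * (_ * X)]/dot.
rewrite big_distrlr/= /dot !mulr_sumr -big_split/=; apply: eq_bigr => i _.
transitivity (\sum_(j < d) (al * (i == j)%:R * (xi 0 i * xi 0 j) +
  be * (e 0 i * xi 0 i * (e 0 j * xi 0 j)))).
  by apply: eq_bigr => j _; rewrite mxE partial2_quad; ring.
rewrite big_split/= -mulr_sumr; congr (_ + _).
rewrite (bigD1 i)//= eqxx mulr1 big1 ?addr0// => j /negPf ji.
by rewrite eq_sym ji mulr0 mul0r.
Qed.

Lemma quadN c al be b e x0 x :
  - quad c al be b e x0 x = quad (- c) (- al) (- be) (- b) e x0 x.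
Proof. by rewrite /quad dotNl; ring. Qed.

Lemma maxform_hess_quad c al b e x0 x : 0 <= al ->
  maxform (hess (quad c al 0 b e x0) x) <= al.
Proof.
move=> al0; rewrite /maxform; set S := (X in sup X).
(* For [d = 0] the unit sphere is empty and [sup] takes its default value 0. *)
have [->|/set0P S0] := eqVneq S set0; first by rewrite sup0.
apply: ge_sup => // _ [xi /= xi1 <-].
by rewrite qform_hess_quad -enorm_sqr xi1 mul0r addr0 expr1n mulr1.
Qed.

Lemma minform_hess_quad c al b e x0 x : 0 <= al ->
  - al <= minform (hess (quad c (- al) 0 b e x0) x).
Proof.
move=> al0; rewrite /minform; set S := (X in inf X).
have [->|/set0P S0] := eqVneq S set0; first by rewrite inf0 oppr_le0.
apply: lb_le_inf => // _ [xi /= xi1 <-].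
by rewrite qform_hess_quad -enorm_sqr xi1 mul0r addr0 expr1n mulr1.
Qed.

(** Contact need not be strict here. At a critical point, contact is required for every curvature
    [eta > 0]: the reading of the operator is then 0 or at most [eta], so the distinction between
    [gamma < 2] and [gamma = 2] disappears in the limit. *)
Definition quad_sub (gamma : R) (G : 'rV[R]_d -> R -> 'rV[R]_d -> R) U u :=
  (forall x0 al be b e, U x0 -> b != 0 ->
     (exists2 r, 0 < r & forall x, enorm (x - x0) < r ->
        u x <= quad (u x0) al be b e x0 x) ->
     0 <= enorm b `^ (- gamma) * (al * dot b b + be * dot e b ^+ 2) +
          G x0 (u x0) b) /\
  (forall x0, U x0 ->
     (forall eta, 0 < eta ->
        exists2 r, 0 < r & forall x, enorm (x - x0) < r ->
          u x <= quad (u x0) eta 0 0 0 x0 x) ->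
     0 <= G x0 (u x0) 0).

Lemma dnear_enorm x0 (P : set 'rV[R]_d) :
  (exists2 r, 0 < r & forall x, enorm (x - x0) < r -> x != x0 -> P x) ->
  \forall x \near x0^', P x.
Proof. by move=> h; apply/near_enormP. Qed.

Lemma limit_ge0 (s t : R) : (forall eta, 0 < eta -> 0 <= s + eta * t) -> 0 <= s.
Proof.
move=> h; have t0 : 0 < `|t| + 1 by rewrite ltr_wpDl.
rewrite leNgt; apply/negP => s0.
have := h (- s / (2 * (`|t| + 1))).
rewrite divr_gt0 ?oppr_gt0 ?mulr_gt0// => /(_ isT).
have -> : s + - s / (2 * (`|t| + 1)) * t =
  s * (2 * (`|t| + 1) - t) / (2 * (`|t| + 1)).
  by field; rewrite gt_eqF.
rewrite pmulr_lge0 ?invr_gt0 ?mulr_gt0//.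
by have := ler_norm t; nra.
Qed.

Lemma quad_strict c al be b e x0 eta x : 0 < eta -> x != x0 ->
  quad c al be b e x0 x < quad c (al + eta) be b e x0 x.
Proof.
move=> eta0 xx0; rewrite -subr_gt0 /quad.
have : 0 < dot (x - x0) (x - x0).
  by rewrite -enorm_sqr exprn_gt0// enorm_gt0 subr_eq0.
nra.
Qed.

(** Extra curvature [eta] makes the contact strict and changes the operator by a multiple of [eta],
    which [limit_ge0] removes. At a critical point one half of [eta] serves for the contact and the
    other half for its strictness. *)
Lemma viscosity_subsolution_quad gamma G U u :
  viscosity_subsolution gamma G U u -> quad_sub gamma G U u.
Proof.
move=> [_ hu]; split=> [x0 al be b e Ux0 b0 [r r0 ub]|x0 Ux0 ub].
  apply: (limit_ge0 (t := enorm b `^ (- gamma) * dot b b)) => eta eta0.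
  have := hu x0 (quad (u x0) (al + eta) be b e x0) Ux0 (C2_near_quad _ _ _ _ _ _ _).
  rewrite {1}/quad subrr !(dotC _ 0) !dot0l expr0n !mulr0 !addr0 => /(_ erefl).
  rewrite /inf_laplacian_sub /inf_laplacian !grad_quad (negPf b0) qform_hess_quad.
  move=> h; have : \forall x \near x0^', u x < quad (u x0) (al + eta) be b e x0 x.
    apply: dnear_enorm; exists r => // x xr xx0.
    apply: le_lt_trans (quad_strict _ _ _ _ _ eta0 xx0).
    exact: ub.
  by move=> /h/le_trans; apply; rewrite le_eqVlt; apply/orP; left; apply/eqP; ring.
apply: (limit_ge0 (t := 1)) => eta eta0.
have eta2 : 0 < eta / 2 by rewrite divr_gt0.
have [r r0 {}ub] := ub _ eta2.
have := hu x0 (quad (u x0) (eta / 2 + eta / 2) 0 0 0 x0) Ux0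
  (C2_near_quad _ _ _ _ _ _ _).
rewrite {1}/quad subrr !(dotC _ 0) !dot0l expr0n !mulr0 !addr0 => /(_ erefl).
rewrite /inf_laplacian_sub !grad_quad eqxx.
move=> h; have : \forall x \near x0^', u x < quad (u x0) (eta / 2 + eta / 2) 0 0 0 x0 x.
  apply: dnear_enorm; exists r => // x xr xx0.
  apply: le_lt_trans (quad_strict _ _ _ _ _ eta2 xx0).
  exact: ub.
move=> /h/le_trans; apply; rewrite [leRHS]addrC lerD2r mulr1 -splitr.
by case: ifP => _; [exact: ltW|exact/maxform_hess_quad/ltW].
Qed.

(** The operator is odd under a change of sign of the test function, with [minform] turning into
    [- maxform]. From here on a supersolution is treated as the subsolution [- v] of the reflected
    equation. *)
Lemma viscosity_supersolution_quad gamma G U (v : 'rV[R]_d -> R) :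
  viscosity_supersolution gamma G U v ->
  quad_sub gamma (fun x r p => - G x (- r) (- p)) U (fun x => - v x).
Proof.
move=> [_ hv]; split=> [x0 al be b e Ux0 b0 [r r0 ub]|x0 Ux0 ub].
  apply: (limit_ge0 (t := enorm b `^ (- gamma) * dot b b)) => eta eta0.
  have := hv x0 (quad (v x0) (- (al + eta)) (- be) (- b) e x0) Ux0
    (C2_near_quad _ _ _ _ _ _ _).
  rewrite {1}/quad subrr !(dotC _ 0) !dot0l expr0n !mulr0 !addr0 => /(_ erefl).
  rewrite /inf_laplacian_super /inf_laplacian !grad_quad oppr_eq0 (negPf b0).
  rewrite qform_hess_quad enormN !dotE opprK.
  move=> h; have : \forall x \near x0^',
      quad (v x0) (- (al + eta)) (- be) (- b) e x0 x < v x.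
    apply: dnear_enorm; exists r => // x xr xx0.
    rewrite -(opprK (v x0)) -quadN ltrNl.
    apply: le_lt_trans (quad_strict _ _ _ _ _ eta0 xx0).
    exact: ub.
  move=> /h; rewrite -oppr_ge0 => /le_trans; apply.
  by rewrite le_eqVlt; apply/orP; left; apply/eqP; rewrite opprK; ring.
apply: (limit_ge0 (t := 1)) => eta eta0.
have eta2 : 0 < eta / 2 by rewrite divr_gt0.
have [r r0 {}ub] := ub _ eta2.
have := hv x0 (quad (v x0) (- (eta / 2 + eta / 2)) 0 0 0 x0) Ux0
  (C2_near_quad _ _ _ _ _ _ _).
rewrite {1}/quad subrr !(dotC _ 0) !dot0l expr0n !mulr0 !addr0 => /(_ erefl).
rewrite /inf_laplacian_super !grad_quad eqxx.
move=> h; have : \forall x \near x0^',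
    quad (v x0) (- (eta / 2 + eta / 2)) 0 0 0 x0 x < v x.
  apply: dnear_enorm; exists r => // x xr xx0.
  have := @quadN (- v x0) (eta / 2 + eta / 2) 0 0 0 x0 x.
  rewrite opprK !oppr0 => <-; rewrite ltrNl.
  apply: le_lt_trans (quad_strict _ _ _ _ _ eta2 xx0).
  exact: ub.
move=> /h; rewrite -oppr_ge0 => /le_trans; apply.
rewrite opprD [leLHS]addrC opprK oppr0 lerD2l mulr1 -splitr lerNl.
by case: ifP => _; [rewrite oppr_le0 ltW|exact/minform_hess_quad/ltW].
Qed.

End Quadratic.

(** * Maxima over compact sets and the one-sided Lipschitz estimate *)

Section Barrier.
Context {R : realType} {d : nat}.
Implicit Types (x y z w p b e : 'rV[R]_d) (K U : set 'rV[R]_d).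
Implicit Types (u : 'rV[R]_d -> R) (G : 'rV[R]_d -> R -> 'rV[R]_d -> R).

(** Stated with Euclidean balls and without the subspace topology, so that restriction to a smaller
    set is immediate. *)
Definition eusc K u := forall x, K x -> forall eps, 0 < eps ->
  exists2 r, 0 < r & forall y, K y -> enorm (y - x) < r -> u y < u x + eps.

Lemma eusc_subset K U u : K `<=` U -> eusc U u -> eusc K u.
Proof.
move=> KU h x Kx eps eps0; have [r r0 hr] := h x (KU _ Kx) _ eps0.
by exists r => // y /KU; exact: hr.
Qed.

Lemma continuous_at_enorm (f : 'rV[R]_d -> R) x : {for x, continuous f} ->
  forall eps, 0 < eps ->
  exists2 r, 0 < r & forall y, enorm (y - x) < r -> `|f y - f x| < eps.
Proof.
move=> cf eps eps0; have /cvgrPdist_lt/(_ _ eps0) := cf.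
by move=> /near_enormP[r r0 h]; exists r => // y yx; rewrite distrC; apply: h.
Qed.

Lemma continuous_enorm_sub x0 : continuous (fun x => enorm (x - x0)).
Proof.
rewrite (_ : (fun _ => _) = Num.sqrt \o (fun x => dot (x - x0) (x - x0))).
  move=> x; apply: continuous_comp; last exact: sqrt_continuous.
  by apply: continuous_dot; exact: continuous_coord_sub.
by apply/funext => x; rewrite /= -enorm_sqr sqrtr_sqr ger0_norm ?enorm_ge0.
Qed.

Lemma compact_usc_sub_max K u (g : 'rV[R]_d -> R) x0 :
  compact K -> K x0 -> eusc K u -> continuous g ->
  exists2 x1, K x1 & forall y, K y -> u y - g y <= u x1 - g x1.
Proof.
move=> cK Kx0 uu cg; apply: compact_usc_max => //; first by exists x0.
move=> x Kx eps eps0; have eps2 : 0 < eps / 2 by rewrite divr_gt0.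
have [r r0 hr] := uu x Kx _ eps2.
have [s s0 hs] := continuous_at_enorm (cg x) eps2.
apply/near_enormP; exists (Num.min r s); first by rewrite lt_min r0 s0.
move=> y; rewrite lt_min => /andP[yr ys] Ky.
by have := hr y Ky yr; have := hs y ys; rewrite ltr_norml => /andP[]; lra.
Qed.

Lemma closed_sublevel (g : 'rV[R]_d -> R) c :
  continuous g -> closed [set x | g x <= c].
Proof. by move=> cg; apply: closed_comp (@closed_le _ c) => x _; exact: cg. Qed.

Lemma compact_in_ball K x0 (r : R) : closed K ->
  (forall x, K x -> enorm (x - x0) <= r) -> compact K.
Proof.
move=> clK hK; apply: bounded_closed_compact => //.
exists (r + enorm x0); split; first exact: num_real.
move=> M hM x Kx; apply: le_trans (ltW hM); apply: le_trans (norm_le_enorm _) _.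
rewrite -{1}(subrK x0 x); apply: le_trans (enormD _ _) _.
by rewrite lerD2r hK.
Qed.

Lemma compact_eball x0 (r : R) : compact [set x | enorm (x - x0) <= r].
Proof.
apply: (@compact_in_ball _ x0 r) => //.
by apply: closed_sublevel; exact: continuous_enorm_sub.
Qed.

(* Squaring, the claim reduces to a * D / r + 2 * (r + a) * eps * q >= 0 with
   a = dot e w, q = dot w w and 0 <= D = q - a ^ 2 <= q. *)
Lemma enorm_taylor e w (r eps : R) : 0 < r -> 0 < eps -> dot e e = 1 ->
  enorm w <= r / 2 -> enorm w <= eps * r ^+ 2 ->
  enorm (r *: e + w) <=
    r + dot e w + (dot w w - dot e w ^+ 2) / (2 * r) + eps * dot w w.
Proof.
move=> r0 eps0 e1 w1 w2.
have ew : `|dot e w| <= enorm w.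
  have := dot_le e w; have -> : enorm e = 1; last by rewrite mul1r.
  by apply/eqP; rewrite -(@eqrXn2 _ 2)// ?enorm_ge0// enorm_sqr e1 expr1n.
have D0 : 0 <= dot w w - dot e w ^+ 2.
  by have := CauchySchwarz_dot e w; rewrite e1 mul1r subr_ge0.
have q0 := dot_ge0 w; move: ew; rewrite ler_norml => /andP[a1 a2].
have -> : (dot w w - dot e w ^+ 2) / (2 * r) =
    ((dot w w - dot e w ^+ 2) / r) / 2 by field; lra.
have Dr : (dot w w - dot e w ^+ 2) / r * r = dot w w - dot e w ^+ 2.
  by rewrite divfK// gt_eqF.
have Dr0 : 0 <= (dot w w - dot e w ^+ 2) / r by rewrite divr_ge0// ltW.
have aD : - eps * r ^+ 2 * ((dot w w - dot e w ^+ 2) / r) <=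
    dot e w * ((dot w w - dot e w ^+ 2) / r) by apply: ler_wpM2r => //; lra.
rewrite ler_enorm; last first.
  by rewrite addr_ge0 ?mulr_ge0 ?(ltW eps0)// addr_ge0 ?divr_ge0//; lra.
rewrite !dotE e1 (dotC w e).
move: Dr Dr0 aD a1 a2 D0 q0; move: (_ / r) => D; move: (dot e w) (dot w w) => a q.
move=> Dr Dr0 aD a1 a2 D0 q0.
have E1 : - eps * r ^+ 2 * D = - eps * r * (q - a ^+ 2) by rewrite -Dr; ring.
have E2 : 0 <= (r / 2 + a) * (eps * q) by rewrite mulr_ge0 ?mulr_ge0 ?(ltW eps0)//; lra.
have E3 : 0 <= (D / 2 + eps * q) ^+ 2 by rewrite sqr_ge0.
have E4 : 0 <= eps * r * a ^+ 2 by rewrite mulr_ge0 ?sqr_ge0 ?mulr_ge0 ?(ltW eps0) ?(ltW r0).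
have -> : (r + a + D / 2 + eps * q) ^+ 2 = r ^+ 2 + 2 * r * a + a ^+ 2 + D * r
  + a * D + 2 * (r / 2 + a) * (eps * q) + r * eps * q + (D / 2 + eps * q) ^+ 2.
  by field.
by rewrite Dr; nra.
Qed.

(** The barrier [A r - M A r^2] has radial second derivative [- 2 M A], and its slope [k] lies
    between 1 and [A] since [M * rho <= 1 / 4]. At a contact point away from the centre the operator
    is then about [- M A k^(2 - gamma)] times a constant above 1, which beats the growth
    [M k^(3 - gamma)] of [G]. *)
Lemma quad_sub_lipschitz gamma G U u x0 (rho M S A : R) :
  quad_sub gamma G U u -> 0 < rho ->
  (forall x, enorm (x - x0) <= rho -> U x) ->
  eusc [set x | enorm (x - x0) <= rho] u ->
  0 < M -> M * rho <= 1 / 4 ->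
  (forall x b, enorm (x - x0) <= rho -> 1 <= enorm b ->
    G x (u x) b <= M * (enorm b `^ (- gamma) * enorm b ^+ 3)) ->
  (forall x, enorm (x - x0) <= rho -> u x <= u x0 + S) ->
  2 <= A -> 2 * S <= A * rho ->
  forall x, enorm (x - x0) <= rho -> u x <= u x0 + A * enorm (x - x0).
Proof.
move=> [hu _] rho0 ballU uu M0 Mrho hG hS A2 AS.
pose g x := A * enorm (x - x0) - M * A * dot (x - x0) (x - x0).
have cg : continuous g.
  rewrite (_ : g = fun x => 0 + 0 + A * enorm (x - x0) +
      (- (M * A)) * enorm (x - x0) ^+ 2); last first.
    by apply/funext => x; rewrite /g enorm_sqr; ring.
  have ce := @continuous_enorm_sub x0.
  by apply: continuous_quadratic; [exact: cst_continuous|exact: ce|exact: ce].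
have [|x1 /= x1b mx] := compact_usc_sub_max (@compact_eball x0 rho) _ uu cg (x0 := x0).
  by rewrite /= subrr enorm0 ltW.
have g0 : g x0 = 0 by rewrite /g subrr enorm0 dot0l !mulr0 subrr.
have [m0|m0] := leP (u x1 - g x1) (u x0).
  move=> x xb; have := le_trans (mx x xb) m0; rewrite lerBlDr => /le_trans; apply.
  by rewrite lerD2l gerBl mulr_ge0 ?dot_ge0// mulr_ge0//; lra.
exfalso.
have x1x0 : x1 != x0 by apply/eqP => E; move: m0; rewrite E g0 subr0 ltxx.
pose r := enorm (x1 - x0).
have r0 : 0 < r by rewrite enorm_gt0 subr_eq0.
have gE x : g x = A * enorm (x - x0) - M * A * enorm (x - x0) ^+ 2.
  by rewrite /g enorm_sqr.
(* On the sphere of radius [rho] the barrier is at least [3 / 4 * (A * rho)], hence above the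
   oscillation [S <= A * rho / 2]. *)
have rrho : r < rho.
  rewrite lt_neqAle x1b andbT; apply/eqP => E.
  have Ar : 0 < A * rho by rewrite mulr_gt0//; lra.
  have : M * rho * (A * rho) <= 1 / 4 * (A * rho) by rewrite ler_wpM2r// ltW.
  have := hS x1 x1b; move: m0; rewrite gE -/r E.
  have -> : M * A * rho ^+ 2 = M * rho * (A * rho) by ring.
  lra.
have [e [e1 eE]] : exists e, dot e e = 1 /\ x1 - x0 = r *: e.
  exists (r^-1 *: (x1 - x0)); split; last first.
    by rewrite scalerA divff ?scale1r// gt_eqF.
  by rewrite dotZl dotZr -enorm_sqr -/r; field; rewrite gt_eqF.
have eps0 : 0 < M / 4 by rewrite divr_gt0.
pose k := A - 2 * (M * A) * r.
have k1 : 1 <= k.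
  have : M * r <= M * rho by rewrite ler_pM2l// ltW.
  move=> /le_trans/(_ Mrho) Mr.
  have : M * r * A <= 1 / 4 * A by rewrite ler_wpM2r//; lra.
  by rewrite /k; lra.
have kb : enorm (k *: e) = k.
  rewrite enormZ ger0_norm; last lra.
  suff -> : enorm e = 1 by rewrite mulr1.
  by apply/eqP; rewrite -(@eqrXn2 _ 2)// ?enorm_ge0// enorm_sqr e1 expr1n.
have ke0 : k *: e != 0 by rewrite -enorm_gt0 kb; lra.
(* The Hessian of the barrier at [x1] is [A / r - 2 M A] transversally and [- 2 M A] radially. The
   term [2 * A * (M / 4)] absorbs the Taylor error of the norm, and leaves the radial curvature
   [- 3 / 2 * (M * A)]. *)
have := hu x1 (A / r + 2 * A * (M / 4) - 2 * (M * A)) (- (A / r)) _ e (ballU _ x1b) ke0.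
have h : exists2 s, 0 < s & forall x, enorm (x - x1) < s -> u x <=
   quad (u x1) (A / r + 2 * A * (M / 4) - 2 * (M * A)) (- (A / r)) (k *: e) e x1 x.
  exists (Num.min (rho - r) (Num.min (r / 2) (M / 4 * r ^+ 2))).
    by rewrite !lt_min subr_gt0 rrho divr_gt0//= mulr_gt0// exprn_gt0.
  move=> x; rewrite !lt_min => /and3P[xr1 xr2 xr3].
  have xx0 : x - x0 = r *: e + (x - x1) by rewrite -eE [RHS]addrC addrA subrK.
  have xb : enorm (x - x0) <= rho.
    by rewrite xx0 -eE; apply: le_trans (enormD _ _) _; rewrite -/r; lra.
  have := mx x xb; rewrite /g.
  have := @enorm_taylor e (x - x1) r _ r0 eps0 e1 (ltW xr2) (ltW xr3).
  rewrite -xx0 -/r /quad => ht.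
  have -> : dot (x - x0) (x - x0) = r ^+ 2 + 2 * r * dot e (x - x1) +
      dot (x - x1) (x - x1).
    by rewrite xx0; move: (x - x1) => w; rewrite !dotE e1 (dotC w e); ring.
  have -> : dot (x1 - x0) (x1 - x0) = r ^+ 2 by rewrite enorm_sqr.
  move: ht; move: (x - x1) => w; rewrite dotZl /k => ht h.
  have {}ht : A * enorm (x - x0) <= A * (r + dot e w +
      (dot w w - dot e w ^+ 2) / (2 * r) + M / 4 * dot w w).
    by apply: ler_wpM2l => //; lra.
  have E : (dot w w - dot e w ^+ 2) / (2 * r) =
    r^-1 / 2 * (dot w w - dot e w ^+ 2) by field; lra.
  by rewrite E in ht; nra.
move=> /(_ h){h}.
have := hG x1 (k *: e) x1b; rewrite kb => /(_ k1).
rewrite !dotE e1 !mulr1.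
have P0 : 0 < k `^ (- gamma) by rewrite powR_gt0; lra.
move=> hG1 h.
have : 0 <= k `^ (- gamma) * (k ^+ 2 * (2 * A * (M / 4) - 2 * (M * A) + M * k)).
  apply: le_trans h _; move: hG1 P0; move: (G _ _ _) (k `^ _) (A / r) => g1 P q.
  by move=> hG1 P0; nra.
rewrite pmulr_rge0// pmulr_rge0; last by rewrite exprn_gt0; lra.
have kA : k <= A by rewrite /k lerBlDr lerDl !mulr_ge0//; lra.
have : M * k <= M * A by rewrite ler_wpM2l// ltW.
have : 0 < M * A by rewrite mulr_gt0//; lra.
lra.
Qed.

End Barrier.

(** * Second differences along the gradient of a subsolution *)

Section SecondDifference.
Context {R : realType} {d : nat}.
Implicit Types (x y z w p b e : 'rV[R]_d) (K U : set 'rV[R]_d).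
Implicit Types (u : 'rV[R]_d -> R) (G : 'rV[R]_d -> R -> 'rV[R]_d -> R).

(** The contact point is only near [x0] and the gradient there only near [p]; this lemma controls
    the resulting error. *)
Lemma continuous_operator (gamma al be : R) p e : p != 0 ->
  {for p, continuous
    (fun b => enorm b `^ (- gamma) * (al * dot b b + be * dot e b ^+ 2))}.
Proof.
move=> p0; apply: (@continuousM _ _ (fun b => enorm b `^ (- gamma))
  (fun b => al * dot b b + be * dot e b ^+ 2)).
  have -> : (fun b => enorm b `^ (- gamma)) =
      (fun t : R => t `^ (- gamma)) \o (fun b => enorm (b - 0)).
    by apply/funext => b; rewrite /= subr0.
  apply: continuous_comp; first exact: continuous_enorm_sub.
  apply: differentiable_continuous; apply/derivable1_diffP.
  have e0 : 0 < enorm (p - 0) by rewrite subr0 enorm_gt0.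
  by have [] := is_derive1_powR (- gamma) e0.
have -> : (fun b => al * dot b b + be * dot e b ^+ 2) =
    quad 0 (2 * al) (2 * be) 0 e 0.
  by apply/funext => b; rewrite /quad subr0 dot0l; field.
exact: continuous_quad.
Qed.

(** Arbitrary end bounds [A], [B] are replaced by bounds of size [T], so that the balancing slope
    stays small. Capping at [2 * k] will cost nothing by the quadratic growth of [u]. Raising one
    bound to [- T] keeps the sum below [a], because the other is at most [2 * k] and
    [2 * k - T < - |a|]. *)
Lemma truncate_bounds (a T k A B : R) : 2 * k + `|a| < T -> 0 <= k -> A + B < a ->
  exists A' B', [/\ `|A'| <= T, `|B'| <= T, A' + B' < a,
    Num.min A (2 * k) <= A' & Num.min B (2 * k) <= B'].
Proof.
move=> hT k0 hAB.
have /andP[a1 a2] : - `|a| <= a <= `|a| by rewrite -ler_norml.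
have a0 := normr_ge0 a.
have h X : exists X', [/\ `|X'| <= T, X' <= 2 * k, Num.min X (2 * k) <= X' &
    X' = - T \/ X' <= X].
  have m1 : Num.min X (2 * k) <= X by rewrite ge_min lexx.
  have m2 : Num.min X (2 * k) <= 2 * k by rewrite ge_min lexx orbT.
  have [mT|mT] := leP (- T) (Num.min X (2 * k)).
    by exists (Num.min X (2 * k)); split; [rewrite ler_norml mT; lra| | |right].
  exists (- T); split; [rewrite normrN ger0_norm; lra|lra|exact: ltW|by left].
have [A' [A1 A2 A3 A4]] := h A; have [B' [B1 B2 B3 B4]] := h B.
by exists A', B'; split => //; case: A4; case: B4 => ? ?; lra.
Qed.

(* A test function p . w + alpha t + a / 2 t^2 + Lambda |y|^2, with t = e . w and
   |y|^2 = |w|^2 - t^2, cannot touch u from above inside the thin box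
   |t| <= s, |y| <= eta s; so u must exceed it on one of the ends t = s, t = -s,
   and alpha is the parameter which balances the two ends. *)
Lemma quad_sub_second_difference gamma G U u x0 p e (tau rho K a eta : R) :
  quad_sub gamma G U u -> 0 < rho ->
  (forall x, enorm (x - x0) <= rho -> U x) ->
  eusc [set x | enorm (x - x0) <= rho] u ->
  dot e e = 1 -> p = tau *: e -> tau != 0 -> 0 <= K ->
  (forall w, enorm w <= rho -> u (x0 + w) - u x0 - dot p w <= K * dot w w) ->
  (forall eps, 0 < eps -> exists2 r, 0 < r & forall x b, enorm (x - x0) <= rho ->
     enorm (x - x0) < r -> u x0 - r < u x -> enorm (b - p) < r ->
     G x (u x) b <= G x0 (u x0) p + eps) ->
  enorm p `^ (- gamma) * (a * dot e p ^+ 2) + G x0 (u x0) p < 0 ->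
  0 < eta -> eta <= 1 ->
  exists2 s0, 0 < s0 & forall s, 0 < s -> s < s0 -> forall A B,
    (forall w, dot e w = s -> dot w w - s ^+ 2 <= (eta * s) ^+ 2 ->
       u (x0 + w) - u x0 - dot p w <= A) ->
    (forall w, dot e w = - s -> dot w w - s ^+ 2 <= (eta * s) ^+ 2 ->
       u (x0 + w) - u x0 - dot p w <= B) ->
    a * s ^+ 2 <= A + B.
Proof.
move=> [hu _] rho0 ballU uu e1 pE tau0 K0 hK hG ha eta0 eta1.
(* [T * s ^+ 2] bounds the truncated end values. [L] makes the transversal term equal to
   [(2 * K + T + |a| + 1) * s ^+ 2] on the lateral side, more than all other terms together. *)
pose T := 2 * K + `|a| + 1.
pose L := (2 * K + T + `|a| + 1) / eta ^+ 2.
have a0 := normr_ge0 a.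
have T0 : 0 < T by rewrite /T; lra.
have eta2 : 0 < eta ^+ 2 by rewrite exprn_gt0.
have L0 : 0 < L by rewrite divr_gt0//; lra.
have LE : L * eta ^+ 2 = 2 * K + T + `|a| + 1 by rewrite divfK// gt_eqF.
have e0 : e != 0 by apply/eqP => E; move: e1; rewrite E dot0l; lra.
have p0 : p != 0 by rewrite pE scaler_eq0 negb_or tau0.
have ee : enorm e = 1.
  by apply/eqP; rewrite -(@eqrXn2 _ 2)// ?enorm_ge0// enorm_sqr e1 expr1n.
have CS w : 0 <= dot w w - dot e w ^+ 2.
  by have := CauchySchwarz_dot e w; rewrite e1 mul1r subr_ge0.
pose N b := enorm b `^ (- gamma) * (2 * L * dot b b + (a - 2 * L) * dot e b ^+ 2).
have NE : N p = enorm p `^ (- gamma) * (a * dot e p ^+ 2).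
  by rewrite /N; congr (_ * _); rewrite pE !dotZl !dotZr e1; ring.
(* One third of the deficit goes to the variation of [N], one third to that of [G], and the last
   third keeps the inequality strict. *)
pose eps := - (N p + G x0 (u x0) p) / 3.
have eps0 : 0 < eps by rewrite divr_gt0// oppr_gt0 NE.
have [r1 r10 hr1] := continuous_at_enorm
  (@continuous_operator gamma (2 * L) (a - 2 * L) p e p0) eps0.
have [r2 r20 hr2] := hG eps eps0.
(* [s * M] dominates the size of the box, the possible drop of [u] at the contact point and the
   deviation of the gradient from [p]; being below [enorm p], it also keeps that gradient
   nonzero. *)
pose M := 2 + 2 * enorm p + T + `|a| + 2 * L.
have pn := enorm_ge0 p.
have M0 : 0 < M by rewrite /M; clear -pn T0 a0 L0; lra.
pose s0 := Num.min 1 (Num.min rho (Num.min (enorm p) (Num.min r1 r2)) / M).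
have m0 : 0 < Num.min rho (Num.min (enorm p) (Num.min r1 r2)).
  by rewrite !lt_min rho0 enorm_gt0 p0 r10 r20.
exists s0; first by rewrite lt_min ltr01 divr_gt0.
move=> s sp; rewrite lt_min ltr_pdivlMr// !lt_min.
move=> /andP[s1 /and4P[sM1 sM2 sM3 sM4]] A B hA hB.
rewrite leNgt; apply/negP => hAB.
have s2 : 0 < s ^+ 2 by rewrite exprn_gt0.
have [||A' [B' [hA' hB' AB' minA minB]]] :=
    @truncate_bounds (a * s ^+ 2) (T * s ^+ 2) (K * s ^+ 2) A B _ _ hAB.
- rewrite normrM (ger0_norm (ltW s2)) mulrA -mulrDl ltr_pM2r// /T.
  by clear; lra.
- by rewrite mulr_ge0// ltW.
have box w : `|dot e w| <= s -> dot w w - dot e w ^+ 2 <= (eta * s) ^+ 2 ->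
    enorm w <= 2 * s /\ dot w w <= 2 * s ^+ 2.
  move=> t1 t2.
  have t3 : dot e w ^+ 2 <= s ^+ 2.
    by rewrite -real_normK ?num_real// ler_sqr ?nnegrE// ltW.
  have t4 : (eta * s) ^+ 2 <= s ^+ 2.
    by rewrite exprMn ler_piMl ?(ltW s2)// expr_le1// ltW.
  have t5 : dot w w <= 2 * s ^+ 2 by clear -t2 t3 t4; lra.
  split=> //; rewrite ler_enorm ?mulr_ge0 ?(ltW sp)//.
  by apply: le_trans t5 _; rewrite exprMn; clear -s2; lra.
have ballw w : enorm w <= 2 * s -> enorm w <= rho.
  have sL : 0 <= s * L by rewrite mulr_ge0// ltW.
  have sp' : 0 <= s * (2 * enorm p + T + `|a|).
    by rewrite mulr_ge0 ?(ltW sp)//; clear -pn T0 a0; lra.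
  by move=> /le_trans; apply; move: sM1; rewrite /M; clear -sL sp'; lra.
have hend w : `|dot e w| = s -> dot w w - dot e w ^+ 2 <= (eta * s) ^+ 2 ->
    u (x0 + w) - u x0 - dot p w <= 2 * (K * s ^+ 2).
  move=> t1 t2; have [|b1 b2] := box w _ t2; first by rewrite t1.
  by apply: le_trans (hK w (ballw _ b1)) _; rewrite mulrCA ler_wpM2l.
have {hA}hA w : dot e w = s -> dot w w - dot e w ^+ 2 <= (eta * s) ^+ 2 ->
    u (x0 + w) - u x0 - dot p w <= A'.
  move=> t1 t2; apply: le_trans minA; rewrite le_min hend// ?andbT.
    by apply: hA; rewrite // -{1}t1.
  by rewrite t1 gtr0_norm.
have {hB}hB w : dot e w = - s -> dot w w - dot e w ^+ 2 <= (eta * s) ^+ 2 ->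
    u (x0 + w) - u x0 - dot p w <= B'.
  move=> t1 t2; apply: le_trans minB; rewrite le_min hend// ?andbT.
    by apply: hB; rewrite // -(sqrrN s) -{1}t1.
  by rewrite t1 normrN gtr0_norm.
(* With this tilt the test function takes at least the values [(A' - B') / 2 + a / 2 * s ^+ 2] and
   [(B' - A') / 2 + a / 2 * s ^+ 2] at the two ends, which exceed [A'] and [B'] because
   [A' + B' < a * s ^+ 2]. *)
pose alpha := (A' - B') / (2 * s).
have alphas : alpha * s = (A' - B') / 2.
  by rewrite /alpha; field; rewrite gt_eqF.
have alphaT : `|alpha| <= T * s.
  rewrite -(ler_pM2r sp) -{1}(gtr0_norm sp) -normrM alphas -mulrA -expr2.
  by move: hA' hB'; rewrite !ler_norml; clear; lra.
pose g x := dot p (x - x0) + alpha * dot e (x - x0) + a / 2 * dot e (x - x0) ^+ 2 +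
  L * (dot (x - x0) (x - x0) - dot e (x - x0) ^+ 2).
have gquad : g = quad 0 (2 * L) (a - 2 * L) (p + alpha *: e) e x0.
  by apply/funext => x; rewrite /g /quad (dotDl p) (dotZl alpha); field.
have cg : continuous g by rewrite gquad; exact: continuous_quad.
pose Bx : set 'rV[R]_d := [set x | dot e (x - x0) ^+ 2 <= s ^+ 2] `&`
  [set x | dot (x - x0) (x - x0) - dot e (x - x0) ^+ 2 <= (eta * s) ^+ 2].
have BxP x : Bx x -> `|dot e (x - x0)| <= s /\ 
    dot (x - x0) (x - x0) - dot e (x - x0) ^+ 2 <= (eta * s) ^+ 2.
  move=> [/= t1 t2]; split => //.
  by rewrite -ler_sqr ?nnegrE ?(ltW sp)// real_normK ?num_real.
have Bxball x : Bx x -> enorm (x - x0) <= rho.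
  by move=> /BxP[t1 t2]; apply: ballw; have [] := box _ t1 t2.
have cBx : compact Bx.
  apply: (compact_in_ball (x0 := x0) (r := rho)) => //.
  apply: closedI.
    apply: closed_sublevel.
    rewrite (_ : (fun _ => _) = quad 0 0 2 0 e x0); first exact: continuous_quad.
    by apply/funext => x; rewrite /quad dot0l; field.
  apply: closed_sublevel.
  rewrite (_ : (fun _ => _) = quad 0 2 (- 2) 0 e x0); first exact: continuous_quad.
  by apply/funext => x; rewrite /quad dot0l; field.
have Bx0 : Bx x0.
  rewrite /Bx/= subrr !(dotC _ 0) !dot0l expr0n/= subr0; split; rewrite ltW//.
  by rewrite exprn_gt0// mulr_gt0.
have [x1 Bx1 mx] := compact_usc_sub_max cBx Bx0 (eusc_subset Bxball uu) cg.
have g0 : g x0 = 0.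
  by rewrite /g subrr !(dotC _ 0) !dot0l expr0n/= subr0 !mulr0 !addr0.
have := mx x0 Bx0; rewrite g0 subr0 => ux1.
have [t1 t2] := BxP _ Bx1; have [t3 t4] := box _ t1 t2.
pose w1 := x1 - x0.
have x1E : x0 + w1 = x1 by rewrite addrC subrK.
have hw1 : u (x0 + w1) - u x0 - dot p w1 >= alpha * dot e w1 +
    a / 2 * dot e w1 ^+ 2 + L * (dot w1 w1 - dot e w1 ^+ 2).
  by rewrite x1E; move: ux1; rewrite /g -/w1; clear; lra.
have t1' : `|dot e w1| < s.
  rewrite lt_neqAle t1 andbT; apply/eqP => E.
  have Q0 : 0 <= L * (dot w1 w1 - dot e w1 ^+ 2) by rewrite mulr_ge0// ltW.
  have E2 : dot e w1 ^+ 2 = s ^+ 2 by rewrite -real_normK ?num_real// E.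
  have [E3|E3] : dot e w1 = s \/ dot e w1 = - s.
  - by move: E; case: (ger0P (dot e w1)) => _ <-; [left|right; rewrite opprK].
  - have := hA _ E3 t2; rewrite E2 in hw1 Q0; rewrite E3 alphas in hw1.
    by clear -hw1 Q0 AB'; lra.
  - have := hB _ E3 t2; rewrite E2 in hw1 Q0; rewrite E3 mulrN alphas in hw1.
    by clear -hw1 Q0 AB'; lra.
(* On the lateral side the penalty [L] outweighs the growth bound [2 * K * s ^+ 2] of [u] together
   with the possibly negative [alpha] and [a] terms. *)
have t2' : dot w1 w1 - dot e w1 ^+ 2 < (eta * s) ^+ 2.
  rewrite lt_neqAle t2 andbT; apply/eqP => E.
  have := hK w1 (ballw _ t3).
  have F1 : K * dot w1 w1 <= K * (2 * s ^+ 2) by rewrite ler_wpM2l.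
  have F2 : L * (dot w1 w1 - dot e w1 ^+ 2) = (2 * K + T + `|a| + 1) * s ^+ 2.
    by rewrite E exprMn mulrA LE.
  have F3 : - (T * s ^+ 2) <= alpha * dot e w1.
    have : `|alpha * dot e w1| <= T * s * s by rewrite normrM ler_pM.
    by rewrite ler_norml => /andP[]; rewrite -mulrA -expr2.
  have F4 : - (`|a| * s ^+ 2) <= a / 2 * dot e w1 ^+ 2.
    have : `|a / 2 * dot e w1 ^+ 2| <= `|a| * s ^+ 2.
      rewrite normrM normrX ler_pM ?exprn_ge0//; last by rewrite ler_sqr ?nnegrE// ltW.
      by rewrite normrM (@ger0_norm _ (2^-1))//; clear -a0; lra.
    by rewrite ler_norml => /andP[].
  by rewrite F2 in hw1; clear -F1 F3 F4 hw1 a0 s2; nra.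
pose b1 := p + (alpha + (a - 2 * L) * dot e w1) *: e + (2 * L) *: w1.
have b1p : enorm (b1 - p) <= (T + `|a| + 2 * L) * s.
  have -> : b1 - p = (alpha + a * dot e w1) *: e + (2 * L) *: (w1 - dot e w1 *: e).
    by apply/rowP => i; rewrite /b1; move: (w1) => w; rewrite !mxE; ring.
  apply: le_trans (enormD _ _) _; rewrite !enormZ ee mulr1.
  have -> : (T + `|a| + 2 * L) * s = T * s + `|a| * s + 2 * L * s by ring.
  apply: lerD.
    apply: le_trans (ler_normD _ _) _; apply: lerD => //.
    by rewrite normrM; apply: ler_wpM2l => //; exact: ltW.
  have L2 : 0 <= 2 * L by rewrite mulr_ge0// ltW.
  rewrite (ger0_norm L2) ler_wpM2l// ler_enorm ?(ltW sp)//.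
  apply: (@le_trans _ _ ((eta * s) ^+ 2)).
    apply: le_trans (ltW t2'); rewrite le_eqVlt; apply/orP; left; apply/eqP.
    move: (w1) => w; rewrite !dotE e1 (dotC w e); ring.
  by rewrite exprMn ler_piMl ?(ltW s2)// expr_le1// ltW.
have b1r r : s * M < r -> enorm (b1 - p) < r.
  move=> /(le_lt_trans _); apply; apply: le_trans b1p _.
  by rewrite mulrC ler_pM2l// /M; clear -pn T0 a0 L0; lra.
have b10 : b1 != 0.
  by apply/eqP => E; have := b1r _ sM2; rewrite E sub0r enormN ltxx.
have touch : exists2 r, 0 < r & forall x, enorm (x - x1) < r ->
    u x <= quad (u x1) (2 * L) (a - 2 * L) b1 e x1 x.
  pose r := Num.min (s - `|dot e w1|) 1.
  have [r3 r30 hr3] : exists2 r, 0 < r & forall x, enorm (x - x1) < r -> Bx x.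
    have c1 : {for x1, continuous (quad 0 0 2 0 e x0)} := continuous_quad (x := x1).
    have c2 : {for x1, continuous (quad 0 2 (- 2) 0 e x0)} := continuous_quad (x := x1).
    have E1 x : quad 0 0 2 0 e x0 x = dot e (x - x0) ^+ 2.
      by rewrite /quad dot0l; field.
    have E2 x : quad 0 2 (- 2) 0 e x0 x =
        dot (x - x0) (x - x0) - dot e (x - x0) ^+ 2.
      by rewrite /quad dot0l; field.
    have d1 : 0 < s ^+ 2 - dot e w1 ^+ 2.
      by rewrite subr_gt0 -[ltLHS]real_normK ?num_real// ltr_sqr ?nnegrE// ltW.
    have d2 : 0 < (eta * s) ^+ 2 - (dot w1 w1 - dot e w1 ^+ 2) by rewrite subr_gt0.
    have [r3 r30 hr3] := continuous_at_enorm c1 d1.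
    have [r4 r40 hr4] := continuous_at_enorm c2 d2.
    exists (Num.min r3 r4); first by rewrite lt_min r30 r40.
    move=> x; rewrite lt_min => /andP[/hr3 + /hr4]; rewrite !E1 !E2 -/w1.
    by rewrite !ltr_norml => /andP[_ x3] /andP[_ x4]; split => /=; clear -x3 x4; lra.
  exists r3 => // x /hr3/mx; rewrite lerBlDr => /le_trans; apply.
  rewrite /g -/w1 /quad.
  have -> : x - x0 = w1 + (x - x1) by rewrite [RHS]addrC addrA subrK.
  rewrite /b1; move: (x - x1) (w1) => w w'.
  rewrite le_eqVlt; apply/orP; left; apply/eqP.
  by rewrite !dotE (dotC w w'); field.
have := hu x1 (2 * L) (a - 2 * L) b1 e (ballU _ (ballw _ t3)) b10 touch.
apply/negP; rewrite -ltNge -/(N b1).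
have Nb1 : N b1 < N p + eps.
  by have := hr1 b1 (b1r _ sM3); rewrite ltr_norml -/(N b1) -/(N p) => /andP[_]; clear; lra.
have x1s : enorm (x1 - x0) < r2.
  apply: le_lt_trans t3 _; apply: le_lt_trans sM4.
  by rewrite mulrC ler_pM2l// /M; clear -pn T0 a0 L0; lra.
(* Upper semicontinuity does not prevent [u] from dropping; maximality against [x0] does, since it
   gives [u x0 + g x1 <= u x1]. *)
have ux1s : u x0 - r2 < u x1.
  apply: (@lt_le_trans _ _ (u x0 + g x1)); last by clear -ux1; lra.
  rewrite ltrD2l; apply: (@lt_le_trans _ _ (- (s * M))); first by rewrite ltrN2.
  have F0 : - (2 * enorm p * s) <= dot p w1.
    have : `|dot p w1| <= enorm p * (2 * s).
      by apply: le_trans (dot_le _ _) _; rewrite ler_wpM2l.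
    by rewrite ler_norml => /andP[]; rewrite mulrCA mulrA.
  have ss : s ^+ 2 <= s by rewrite expr2 ler_piMl// ltW.
  have F3 : - (T * s) <= alpha * dot e w1.
    have : `|alpha * dot e w1| <= T * s * 1.
      by rewrite normrM ler_pM// ltW// (lt_trans t1').
    by rewrite ler_norml mulr1 => /andP[].
  have F4 : - (`|a| * s) <= a / 2 * dot e w1 ^+ 2.
    have : `|a / 2 * dot e w1 ^+ 2| <= `|a| * s.
      rewrite normrM normrX ler_pM ?exprn_ge0//.
        by rewrite normrM (@ger0_norm _ (2^-1))//; clear -a0; lra.
      by apply: le_trans ss; rewrite ler_sqr ?nnegrE// ltW.
    by rewrite ler_norml => /andP[].
  have F5 : 0 <= L * (dot w1 w1 - dot e w1 ^+ 2) by rewrite mulr_ge0// ltW.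
  have F6 : 0 <= L * s by rewrite mulr_ge0// ltW.
  by rewrite /g -/w1 /M; clear -F0 F3 F4 F5 F6 sp; lra.
have := hr2 x1 b1 (ballw _ t3) x1s ux1s (b1r _ sM4).
by move: eps0 Nb1; rewrite /eps; clear; lra.
Qed.

End SecondDifference.

(** * Combining the two equations at a maximum of the doubled functional *)

Section Doubling.
Context {R : realType} {d : nat}.
Implicit Types (x y z w p b e : 'rV[R]_d) (K U : set 'rV[R]_d).
Implicit Types (u v : 'rV[R]_d -> R) (G : 'rV[R]_d -> R -> 'rV[R]_d -> R).

(** The lower bound on [u x] is essential: [G] contains [c * F (u x)] with [c <= 0], which grows
    when [u] drops. *)
Definition usc_along G K u x0 p := forall eps, 0 < eps ->
  exists2 r, 0 < r & forall x b, K x ->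
     enorm (x - x0) < r -> u x0 - r < u x -> enorm (b - p) < r ->
     G x (u x) b <= G x0 (u x0) p + eps.

(* Plays the role of the theorem on sums: only the second difference in the
   direction e of the gradient matters for the infinity Laplacian. *)
Lemma quad_sub_doubling gamma G1 G2 U u v x0 y0 p e (tau rho K : R) :
  quad_sub gamma G1 U u -> quad_sub gamma G2 U v -> 0 < rho ->
  (forall x, enorm (x - x0) <= rho -> U x) ->
  (forall x, enorm (x - y0) <= rho -> U x) ->
  eusc [set x | enorm (x - x0) <= rho] u ->
  eusc [set x | enorm (x - y0) <= rho] v ->
  dot e e = 1 -> p = tau *: e -> tau != 0 -> 0 <= K ->
  (forall w w', enorm w <= rho -> enorm w' <= rho ->
     u (x0 + w) + v (y0 + w') <=
     u x0 + v y0 + dot p (w - w') + K * dot (w - w') (w - w')) ->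
  usc_along G1 [set x | enorm (x - x0) <= rho] u x0 p ->
  usc_along G2 [set x | enorm (x - y0) <= rho] v y0 (- p) ->
  0 <= G1 x0 (u x0) p + G2 y0 (v y0) (- p).
Proof.
move=> hu hv rho0 Ux Uy uu uv e1 pE tau0 K0 hK hG1 hG2.
rewrite leNgt; apply/negP => hG.
have p0 : p != 0.
  rewrite pE scaler_eq0 negb_or tau0; apply/eqP => E.
  by move: e1; rewrite E dot0l => /eqP; rewrite eq_sym oner_eq0.
set g1 := G1 _ _ _ in hG; set g2 := G2 _ _ _ in hG.
pose N := enorm p `^ (- gamma) * dot e p ^+ 2.
have N0 : 0 < N.
  rewrite mulr_gt0 ?powR_gt0 ?enorm_gt0// exprn_even_gt0//=.
  by rewrite pE dotZr e1 mulr1.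
have NE a : enorm p `^ (- gamma) * (a * dot e p ^+ 2) = a * N by rewrite /N; ring.
(* [a1] and [a2] leave a deficit [s / 4] in each inequality, and still
   [(a1 + a2) * N = s / 2 > 0]. *)
pose s := - (g1 + g2); have s0 : 0 < s by rewrite oppr_gt0.
pose a1 := (- g1 - s / 4) / N; pose a2 := (- g2 - s / 4) / N.
have a1E : a1 * N = - g1 - s / 4 by rewrite divfK// gt_eqF.
have a2E : a2 * N = - g2 - s / 4 by rewrite divfK// gt_eqF.
have a0 : 0 < a1 + a2.
  by rewrite -(pmulr_lgt0 _ N0) mulrDl a1E a2E; move: s0; rewrite /s; clear; lra.
(* Thin enough for the cost [8 * K * eta ^+ 2 * t ^+ 2] of the two discs to stay below
   [(a1 + a2) * t ^+ 2]. *)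
pose eta := Num.min 1 ((a1 + a2) / (8 * K + 1)).
have K8 : 0 < 8 * K + 1 by rewrite ltr_wpDl// mulr_ge0.
have eta0 : 0 < eta by rewrite lt_min ltr01 divr_gt0.
have eta1 : eta <= 1 by rewrite ge_min lexx.
have eta2 : 8 * K * eta ^+ 2 < a1 + a2.
  have : eta * (8 * K + 1) <= a1 + a2.
    by rewrite -ler_pdivlMr// ge_min lexx orbT.
  have : 8 * K * eta ^+ 2 <= 8 * K * eta.
    by rewrite ler_wpM2l ?mulr_ge0// expr2 ler_piMl// ltW.
  by clear -eta0; lra.
have hKu w : enorm w <= rho -> u (x0 + w) - u x0 - dot p w <= K * dot w w.
  move=> /(hK w 0) h; move: h; rewrite enorm0 ltW// subr0 addr0 => /(_ isT).
  by clear; lra.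
have hKv w : enorm w <= rho -> v (y0 + w) - v y0 - dot (- p) w <= K * dot w w.
  move=> h; have := hK 0 w; rewrite enorm0 ltW// h sub0r addr0 => /(_ isT isT).
  by rewrite !dotNl !dotNr opprK; clear; lra.
have E1 : enorm p `^ (- gamma) * (a1 * dot e p ^+ 2) + G1 x0 (u x0) p < 0.
  by rewrite NE a1E -/g1; move: s0; clear; lra.
have E2 : enorm (- p) `^ (- gamma) * (a2 * dot e (- p) ^+ 2) + G2 y0 (v y0) (- p) < 0.
  by rewrite enormN dotNr sqrrN NE a2E -/g2; move: s0; clear; lra.
have pE' : - p = - tau *: e by rewrite pE scaleNr.
have tau0' : - tau != 0 by rewrite oppr_eq0.
have [s1 s10 hs1] := quad_sub_second_difference hu rho0 Ux uu e1 pE tau0 K0 hKu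
  hG1 E1 eta0 eta1.
have [s2 s20 hs2] := quad_sub_second_difference hv rho0 Uy uv e1 pE' tau0' K0 hKv
  hG2 E2 eta0 eta1.
pose t := Num.min (Num.min s1 s2) rho / 2.
have m0 : 0 < Num.min (Num.min s1 s2) rho by rewrite !lt_min s10 s20.
have t0 : 0 < t by rewrite divr_gt0.
have : t < Num.min (Num.min s1 s2) rho by rewrite ltr_pdivrMr// ltr_pMr// ltr1n.
rewrite !lt_min => /andP[/andP[ts1 ts2] _].
have trho : 2 * t <= rho by rewrite mulrC divfK// ge_min lexx orbT.
clearbody t; have tt : 0 < t ^+ 2 by rewrite exprn_gt0.
have sl w : dot w w - t ^+ 2 <= (eta * t) ^+ 2 -> enorm w <= rho.
  move=> h; apply: le_trans trho; rewrite ler_enorm ?mulr_ge0 ?(ltW t0)//.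
  have : (eta * t) ^+ 2 <= t ^+ 2.
    by rewrite exprMn ler_piMl ?(ltW tt)// expr_le1// ltW.
  by rewrite (exprMn 2); move: h tt; clear; lra.
pose ka := 4 * K * (eta * t) ^+ 2.
(* Two points of the same disc have equal components along [e], so they differ by at most
   [2 * eta * t]; the linear terms in [p] cancel. *)
have cross : forall (c : R) w w', c ^+ 2 = t ^+ 2 -> dot e w = c -> dot e w' = c ->
    dot w w - t ^+ 2 <= (eta * t) ^+ 2 -> dot w' w' - t ^+ 2 <= (eta * t) ^+ 2 ->
    u (x0 + w) - u x0 - dot p w + (v (y0 + w') - v y0 - dot (- p) w') <= ka.
  move=> c w w' cE ew ew' hw hw'; have := hK w w' (sl _ hw) (sl _ hw').
  rewrite dotNl dotDr dotNr.
  have : K * dot (w - w') (w - w') <= ka.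
    rewrite /ka (mulrC 4) -mulrA ler_wpM2l//.
    have := dot_ge0 ((w - c *: e) + (w' - c *: e)).
    have : dot (w - c *: e) (w - c *: e) = dot w w - c ^+ 2.
      by rewrite !dotE e1 (dotC w e) ew; ring.
    have : dot (w' - c *: e) (w' - c *: e) = dot w' w' - c ^+ 2.
      by rewrite !dotE e1 (dotC w' e) ew'; ring.
    have -> : w - w' = (w - c *: e) - (w' - c *: e).
      by rewrite opprB addrA subrK.
    rewrite cE; move: (w - c *: e) (w' - c *: e) => z z' h1 h2.
    rewrite !dotE (dotC z' z); move: h1 h2 hw hw'; clear; lra.
  by clear; lra.
(* One supremum suffices, that of the increments of [v] at the end [- t]. [cross] turns it into a
   bound for [u] at [- t]; the second difference of [u] and [cross] at [t] then bound [v] at [t].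
   The second difference of [v] closes the loop with [(a1 + a2) * t ^+ 2 <= 2 * ka]. *)
pose Sm : set R := [set v (y0 + w) - v y0 - dot (- p) w | w in
  [set w | dot e w = - t /\ dot w w - t ^+ 2 <= (eta * t) ^+ 2]].
have supS : has_sup Sm.
  split.
    exists (v (y0 + - t *: e) - v y0 - dot (- p) (- t *: e)), (- t *: e) => //.
    rewrite /= !dotZr dotZl e1 !mulr1 mulrN mulNr opprK -expr2 subrr.
    by rewrite exprn_ge0// mulr_ge0// ltW.
  exists (ka - (u (x0 + - t *: e) - u x0 - dot p (- t *: e))).
  move=> _ [w [ew hw] <-]; rewrite lerBrDl; apply: (cross (- t)) => //.
  - exact: sqrrN.
  - by rewrite dotZr e1 mulr1.
  - rewrite !dotZr dotZl e1 !mulr1 mulrN mulNr opprK -expr2 subrr.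
    by rewrite exprn_ge0// mulr_ge0// ltW.
have hBu w : dot e w = - t -> dot w w - t ^+ 2 <= (eta * t) ^+ 2 ->
    u (x0 + w) - u x0 - dot p w <= ka - sup Sm.
  move=> ew hw; rewrite lerBrDr -lerBrDl; apply: ge_sup => [|_ [w' [ew' hw'] <-]].
    exact: supS.1.
  by rewrite lerBrDl; apply: (cross (- t)) => //; exact: sqrrN.
have hAv w : dot e w = t -> dot w w - t ^+ 2 <= (eta * t) ^+ 2 ->
    v (y0 + w) - v y0 - dot (- p) w <= 2 * ka - sup Sm - a1 * t ^+ 2.
  move=> ew hw.
  have := hs1 t t0 ts1 (ka - (v (y0 + w) - v y0 - dot (- p) w)) (ka - sup Sm) _ hBu.
  move=> h; suff : a1 * t ^+ 2 <= ka - (v (y0 + w) - v y0 - dot (- p) w) + (ka - sup Sm).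
    by clear; lra.
  by apply: h => w' ew' hw'; rewrite lerBrDr; exact: (cross t).
have hBv w : dot e w = - t -> dot w w - t ^+ 2 <= (eta * t) ^+ 2 ->
    v (y0 + w) - v y0 - dot (- p) w <= sup Sm.
  by move=> ew hw; apply: (ub_le_sup supS.2); exists w.
have := hs2 t t0 ts2 _ _ hAv hBv.
suff : 2 * ka < (a1 + a2) * t ^+ 2 by clear; lra.
have -> : 2 * ka = 8 * K * eta ^+ 2 * t ^+ 2 by rewrite /ka; ring.
by rewrite ltr_pM2r.
Qed.

(** A Lebesgue number argument along the diagonal. Radii are halved so that [z] stays in the ball
    around [x] when [y] does and [z] is close to [y]. *)
Lemma compact_uniform K (P : R -> 'rV[R]_d -> 'rV[R]_d -> Prop) : compact K ->
  (forall x, K x -> exists2 r, 0 < r & forall y z t, K y -> K z ->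
     enorm (y - x) < r -> enorm (z - x) < r -> 0 < t -> t < r -> P t y z) ->
  exists2 t, 0 < t & forall y z, K y -> K z -> enorm (y - z) < t -> P t y z.
Proof.
move=> /compact_near_coveringP/near_covering_withinP cK hP.
suff : \forall t \near (0 : R)^'+, K `<=` (fun y => forall z, K z ->
    enorm (y - z) < t -> P t y z).
  move=> h; have [t [/= t0 ht]] : exists t : R, (fun t => 0 < t) t /\
      K `<=` (fun y => forall z, K z -> enorm (y - z) < t -> P t y z).
    by apply: (@filter_ex _ (0 : R)^'+); apply: filterI => //; exact: nbhs_right_gt.
  by exists t => // y z Ky Kz; exact: ht.
apply: cK => x Kx; have [r r0 hr] := hP x Kx.
  have r2 : 0 < r / 2 by rewrite divr_gt0.
  exists ([set y | enorm (y - x) < r / 2], [set t | 0 < t < r / 2]) => /=.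
    split; first by apply/near_enormP; exists (r / 2).
    near=> t; apply/andP; split; near: t; [exact: nbhs_right_gt|exact: nbhs_right_lt].
  move=> [y t] /= [yx /andP[t0 tr]] Ky z Kz yz; apply: hr => //.
  - by move: yx r2; clear; lra.
  - rewrite -(subrK y z) -addrA; apply: le_lt_trans (enormD _ _) _.
    by rewrite enormBC; move: yx yz tr; clear; lra.
  - by move: tr r2; clear; lra.
Unshelve. all: by end_near. Qed.

(** Since [c <= 0] and [F] increases, a drop of [u] by at most [r4 / 2] raises [c * F (u x)] by no
    more than [- c x * e1]. The constant [e1] keeps all errors from [c] and [F] within [eps / 4]. *)
Lemma usc_along_hamiltonian K (H : 'rV[R]_d -> 'rV[R]_d -> R) (c h : 'rV[R]_d -> R)
    (F : R -> R) u x0 p : K x0 ->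
  (forall eps, 0 < eps -> exists2 r, 0 < r & forall x b, K x ->
     enorm (x - x0) < r -> enorm (b - p) < r -> `|H x b - H x0 p| < eps) ->
  (forall eps, 0 < eps -> exists2 r, 0 < r & forall x, K x ->
     enorm (x - x0) < r -> `|c x - c x0| < eps) ->
  (forall eps, 0 < eps -> exists2 r, 0 < r & forall x, K x ->
     enorm (x - x0) < r -> `|h x - h x0| < eps) ->
  {homo F : s t / s < t} -> {for u x0, continuous F} ->
  (forall x, K x -> c x <= 0) ->
  usc_along (fun x r p => H x p + c x * F r - h x) K u x0 p.
Proof.
move=> Kx0 hH hc hh Fi Fc c0 eps eps0.
have Fw s t : s <= t -> F s <= F t by rewrite le_eqVlt => /orP[/eqP->//|/Fi/ltW].
have M0 : 0 < 4 * (`|F (u x0)| + `|c x0| + 1).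
  by rewrite mulr_gt0// ltr_wpDl// addr_ge0.
pose e1 := Num.min 1 (eps / (4 * (`|F (u x0)| + `|c x0| + 1))).
have e10 : 0 < e1 by rewrite lt_min ltr01 divr_gt0.
have e11 : e1 <= 1 by rewrite ge_min lexx.
have e1M : e1 * (4 * (`|F (u x0)| + `|c x0| + 1)) <= eps.
  by rewrite -ler_pdivlMr// ge_min lexx orbT.
have eps4 : 0 < eps / 4 by rewrite divr_gt0.
have [r1 r10 hr1] := hH _ eps4; have [r2 r20 hr2] := hc _ e10.
have [r3 r30 hr3] := hh _ eps4.
have /cvgrPdist_lt/(_ _ e10) := Fc; rewrite near_nbhs => /nbhs_ballP[r4 /= r40 hr4].
exists (Num.min (Num.min r1 r2) (Num.min r3 (r4 / 2))).
  by rewrite !lt_min r10 r20 r30 divr_gt0.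
move=> x b Kx; rewrite !lt_min => /andP[/andP[x1 x2] /andP[x3 _]].
set r := Num.min _ _ => ux /andP[/andP[b1 _] _].
have r4r : r <= r4 / 2 by rewrite /r !ge_min lexx !orbT.
have := hr1 x b Kx x1 b1; have := hr2 x Kx x2; have := hr3 x Kx x3.
have : `|F (u x0) - F (u x0 - r4 / 2)| < e1.
  apply: hr4; rewrite /ball/= opprB addrC subrK gtr0_norm ?divr_gt0//.
  by rewrite ltr_pdivrMr// ltr_pMr// ltr1n.
have Fu : F (u x0 - r4 / 2) <= F (u x).
  by apply: Fw; move: ux r4r; clear; lra.
rewrite !ltr_norml => /andP[_ f1] /andP[h1 h2] /andP[c1 c2] /andP[H1 H2].
have cx := c0 x Kx.
have E1 : c x * F (u x) <= c x * (F (u x0) - e1).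
  by rewrite ler_wnM2l//; move: f1 Fu; clear; lra.
have E2 : (c x - c x0) * F (u x0) <= e1 * `|F (u x0)|.
  apply: le_trans (ler_norm _) _; rewrite normrM ler_wpM2r//.
  by rewrite ler_norml; move: c1 c2; clear; lra.
have E3 : - c x * e1 <= (`|c x0| + 1) * e1.
  rewrite ler_wpM2r ?(ltW e10)//.
  have := ler_norm (- c x0); rewrite normrN; move: c1 e11; clear; lra.
by move: E1 E2 E3 e1M h1 H2 eps0; clear; lra.
Qed.

End Doubling.

(** * Uniform strictness near the diagonal and existence of the doubled maximum *)

Section Comparison.
Context {R : realType} {d : nat}.
Implicit Types (x y z w p b e : 'rV[R]_d) (K O : set 'rV[R]_d).
Implicit Types (u v c h : 'rV[R]_d -> R).

Lemma within_continuous_bounded K c : compact K -> {within K, continuous c} ->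
  exists2 B, 0 <= B & forall x, K x -> `|c x| <= B.
Proof.
move=> cK cc; have [[x0 Kx0]|K0] := pselect (K !=set0); last first.
  by exists 0 => // x Kx; case: K0; exists x.
have cu : eusc K (fun x => `|c x|).
  move=> x Kx eps eps0; have [r r0 hr] := within_continuous_enorm cc Kx eps0.
  exists r => // y Ky /(hr _ Ky) h.
  by have := ler_distD 0 (c y) (c x); have := lerB_dist (c y) (c x); move: h; clear; lra.
have [x1 Kx1 h] := compact_usc_sub_max cK Kx0 cu (@cst_continuous _ _ 0).
by exists `|c x1| => // y /h; rewrite !subr0.
Qed.

(** Strict monotonicity carries no rate by itself; the minimum of [F (t + m) - F t] over the compact
    interval [[- M, M]] supplies one. This makes case (a) strict. *)
Lemma increasing_gap (F : R -> R) (M m : R) : 0 <= M -> 0 < m ->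
  continuous F -> {homo F : s t / s < t} ->
  exists2 k, 0 < k & forall s t, `|t| <= M -> t + m <= s -> k <= F s - F t.
Proof.
move=> M0 m0 cF iF.
have [||r _ hr] := @EVT_min R (fun t => F (t + m) - F t) (- M) M.
- lra.
- apply: continuous_subspaceT => t; apply: cvgB; last exact: cF.
  by apply: continuous_comp; [apply: cvgD; [exact: cvg_id|exact: cvg_cst]|exact: cF].
exists (F (r + m) - F r); first by rewrite subr_gt0 iF// ltrDl.
move=> s t tM ts; apply: le_trans (hr t _) _; first by rewrite in_itv/= -ler_norml.
by rewrite lerB//; move: ts; rewrite le_eqVlt => /orP[/eqP->//|/iF/ltW].
Qed.

(** Both cases (a) and (b) become one gap [t], uniform over nearby pairs. Near a point with
    [u - v < m] semicontinuity excludes such pairs; any other point is interior because [u <= v] on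
    the boundary. *)
Lemma strict_separation O (c h1 h2 u v : 'rV[R]_d -> R) (F : R -> R) (M m : R) :
  compact (closure O) -> open O -> 0 < m -> 0 <= M ->
  {within closure O, continuous c} ->
  {within closure O, continuous h1} ->
  {within closure O, continuous h2} ->
  continuous F -> {homo F : s t / s < t} ->
  usc_on (closure O) u -> usc_on (closure O) (fun x => - v x) ->
  (forall x, closure O x -> `|v x| <= M) ->
  (forall x, boundary O x -> u x <= v x) ->
  (forall x, closure O x -> c x < 0 /\ h2 x <= h1 x) \/
  (forall x, closure O x -> c x <= 0 /\ h2 x < h1 x) ->
  exists2 t, 0 < t & forall x y, closure O x -> closure O y ->
    enorm (x - y) < t -> m <= u x - v y ->
    (forall z, enorm (z - x) < t -> O z) /\
    (c x * F (u x) - h1 x) - (c y * F (v y) - h2 y) <= - t.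
Proof.
move=> cK oO m0 M0 cc ch1 ch2 cF iF uu uv vM uvb ab.
apply: (@compact_uniform _ _ (closure O) (fun t x y => m <= u x - v y ->
    (forall z, enorm (z - x) < t -> O z) /\
    (c x * F (u x) - h1 x) - (c y * F (v y) - h2 y) <= - t)) => // x0 Kx0.
have [lt|ge] := ltP (u x0 - v x0) m.
  have g0 : 0 < (m - (u x0 - v x0)) / 2 by rewrite divr_gt0// subr_gt0.
  have [r1 r10 hr1] := usc_on_enorm uu Kx0 g0.
  have [r2 r20 hr2] := usc_on_enorm uv Kx0 g0.
  exists (Num.min r1 r2); first by rewrite lt_min r10 r20.
  move=> y z t Ky Kz; rewrite !lt_min => /andP[y1 _] /andP[_ z2] _ _.
  by have := hr1 y Ky y1; have := hr2 z Kz z2; clear; lra.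
have Ox0 : O x0.
  apply: contrapT => nO; have /uvb : boundary O x0.
    by split => //; move=> /interior_subset.
  by move: ge m0; clear; lra.
have [r1 r10 hr1] : exists2 r, 0 < r & forall z, enorm (z - x0) < r -> O z.
  by apply/near_enormP; exact: open_nbhs_nbhs.
have Fw s t : s <= t -> F s <= F t by rewrite le_eqVlt => /orP[/eqP->//|/iF/ltW].
have [k k0 hk] := increasing_gap M0 m0 cF iF.
have c0 x : closure O x -> c x <= 0.
  by move=> Kx; case: ab => /(_ x Kx)[]// /ltW.
have [th th0 [r2 r20 hr2]] : exists2 th, 0 < th & exists2 r, 0 < r &
    forall y z, closure O y -> closure O z -> enorm (y - x0) < r ->
      m <= u y - v z ->
      c y * (F (u y) - F (v z)) + (h2 x0 - h1 x0) <= - th.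
  case: ab => hab; have [cx hx] := hab _ Kx0.
    have cx2 : 0 < - c x0 / 2 by rewrite divr_gt0// oppr_gt0.
    have [r r0 hr] := within_continuous_enorm cc Kx0 cx2.
    exists (- c x0 / 2 * k); first by rewrite mulr_gt0.
    exists r => // y z Ky Kz /(hr y Ky); rewrite ltr_norml => /andP[_ cy] uyz.
    have := hk (u y) (v z) (vM z Kz).
    have -> : (v z + m <= u y) = true by move: uyz; clear; lra.
    move=> /(_ isT) hF.
    have : c y * (F (u y) - F (v z)) <= c y * k by rewrite ler_wnM2l// c0.
    have : c y * k <= c x0 / 2 * k.
      by rewrite ler_wpM2r ?(ltW k0)//; move: cy; clear; lra.
    by move: hx; clear; lra.
  exists (h1 x0 - h2 x0); first by rewrite subr_gt0.
  exists 1 => // y z Ky Kz _ uyz.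
  have : F (v z) <= F (u y) by apply: Fw; move: uyz m0; clear; lra.
  rewrite -subr_ge0 => hF.
  have : c y * (F (u y) - F (v z)) <= 0 by rewrite mulr_le0_ge0// c0.
  by clear; lra.
pose MF := `|F M| + `|F (- M)|.
have hMF z : closure O z -> `|F (v z)| <= MF.
  move=> /vM; rewrite ler_norml => /andP[/Fw f1 /Fw f2]; rewrite ler_norml /MF.
  have := ler_norm (F M); have := ler_norm (- F (- M)); rewrite normrN.
  have := normr_ge0 (F M); have := normr_ge0 (F (- M)).
  by move: f1 f2; clear; lra.
have MF0 : 0 <= MF by rewrite addr_ge0.
(* Freezing [c], [h1] and [h2] at [x0] costs at most [2 * e * MF + 2 * e = th / 2], and [t] is kept
   below the remaining [th / 2]. *)
pose e := th / (4 * (MF + 1)).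
have MF4 : 0 < 4 * (MF + 1) by rewrite mulr_gt0// ltr_wpDl.
have e0 : 0 < e by rewrite divr_gt0.
have eE : e * (4 * (MF + 1)) = th by rewrite divfK// gt_eqF.
have [r3 r30 hr3] := within_continuous_enorm cc Kx0 e0.
have [r4 r40 hr4] := within_continuous_enorm ch1 Kx0 e0.
have [r5 r50 hr5] := within_continuous_enorm ch2 Kx0 e0.
exists (Num.min (Num.min (r1 / 2) (Num.min r2 (th / 2)))
    (Num.min r3 (Num.min r4 r5))).
  by rewrite !lt_min r20 r30 r40 r50 !divr_gt0.
move=> y z t Ky Kz; rewrite !lt_min.
move=> /andP[/and3P[y1 y2 _] /and3P[y3 y4 _]] /andP[_ /and3P[z3 _ z5]] _.
move=> /andP[/and3P[t1 _ tth] _] uyz; split.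
  move=> x xy; apply: hr1; rewrite -(subrK y x) -addrA.
  by apply: le_lt_trans (enormD _ _) _; move: xy y1 t1; clear; lra.
have := hr2 y z Ky Kz y2 uyz; have := hMF z Kz.
have := hr3 y Ky y3; have := hr3 z Kz z3; have := hr4 y Ky y4; have := hr5 z Kz z5.
have : (c y - c z) * F (v z) <= `|c y - c z| * `|F (v z)|.
  by rewrite -normrM ler_norm.
have : `|c y - c z| <= `|c y - c x0| + `|c z - c x0|.
  by rewrite (distrC (c z)) ler_distD.
rewrite !ltr_norml.
move=> a1 a2 /andP[_ b1] /andP[b2 _] c1 c2 a3 a4.
have : `|c y - c z| * `|F (v z)| <= 2 * e * MF.
  apply: ler_pM => //; apply: le_trans a1 _.
  have : `|c y - c x0| < e by rewrite ltr_norml.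
  have : `|c z - c x0| < e by rewrite ltr_norml.
  by clear; lra.
by move: a2 b1 b2 a4 eE tth; clear; lra.
Qed.

Lemma doubling_max K u v (k : R) x0 : compact K -> K x0 ->
  usc_on K u -> usc_on K (fun x => - v x) ->
  exists x1 y1, [/\ K x1, K y1 & forall x y, K x -> K y ->
    u x - v y - k * dot (x - y) (x - y) ^+ 2 <=
    u x1 - v y1 - k * dot (x1 - y1) (x1 - y1) ^+ 2].
Proof.
move=> cK Kx0 uu uv.
pose pen (z : 'rV[R]_d * 'rV[R]_d) := dot (z.1 - z.2) (z.1 - z.2).
have cpen : continuous pen.
  have cco i : continuous (fun z : 'rV[R]_d * 'rV[R]_d => (z.1 - z.2) 0 i).
    rewrite (_ : (fun _ => _) = (fun z : 'rV[R]_d * 'rV[R]_d => z.1 0 i) -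
        (fun z : 'rV[R]_d * 'rV[R]_d => z.2 0 i)); last first.
      by apply/funext => z; rewrite !mxE.
    move=> z; apply: continuousB.
      by apply: (@continuous_comp _ _ _ fst (fun x : 'rV[R]_d => x 0 i));
        [exact: cvg_fst|exact: coord_continuous].
    by apply: (@continuous_comp _ _ _ snd (fun x : 'rV[R]_d => x 0 i));
      [exact: cvg_snd|exact: coord_continuous].
  exact: continuous_dot.
have cg : continuous (fun q => 0 + 0 + 0 * 0 + k * pen q ^+ 2).
  by apply: continuous_quadratic => //; exact: cst_continuous.
have [||[x1 y1] [/= Kx1 Ky1] h] := @compact_usc_max R _ (K `*` K)
  (fun q => u q.1 - v q.2 - (0 + 0 + 0 * 0 + k * pen q ^+ 2)) (compact_setX cK cK).
- by exists (x0, x0).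
- move=> [x y] [/= Kx Ky] eps eps0.
  have eps3 : 0 < eps / 3 by rewrite divr_gt0.
  have [r r0 hr] := usc_on_enorm uu Kx eps3.
  have [s s0 hs] := usc_on_enorm uv Ky eps3.
  have /cvgrPdist_lt/(_ _ eps3) n1 := cg (x, y).
  have n2 : \forall q \near ((x, y) : 'rV[R]_d * 'rV[R]_d),
      enorm (q.1 - x) < r /\ enorm (q.2 - y) < s.
    exists ([set z | enorm (z - x) < r], [set z | enorm (z - y) < s]) => /=.
      by split; apply/near_enormP; [exists r|exists s].
    by move=> [x' y'].
  apply: filterS2 n2 n1.
  move=> [x' y'] /= [x'r y's]; rewrite ltr_norml => /andP[h1 h2] [Kx' Ky'].
  have := hr x' Kx' x'r; have := hs y' Ky' y's.
  by move: h1 h2; clear; lra.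
exists x1, y1; split => // x y Kx Ky.
by have := h (x, y) (conj Kx Ky); rewrite /= mul0r !add0r.
Qed.

End Comparison.

(** * The comparison principle *)

Theorem theorem2p1 (R : realType) (d : nat) (d_gt0 : (0 < d)%N)
    (gamma : R) (gamma_ge0 : 0 <= gamma) (gamma_le2 : gamma <= 2)
    (O : set 'rV[R]_d) (domO : domain O) (bndO : bounded_set O)
    (c h1 h2 : 'rV[R]_d -> R)
    (c_cont : {within closure O, continuous c})
    (h1_cont : {within closure O, continuous h1})
    (h2_cont : {within closure O, continuous h2})
    (F : R -> R) (F_cont : continuous F) (F_incr : {homo F : s t / s < t})
    (H : 'rV[R]_d -> 'rV[R]_d -> R)
    (H_cont : {within closure O `*` setT,
                 continuous (fun z : 'rV[R]_d * 'rV[R]_d => H z.1 z.2)})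
    (beta C : R) (beta_gt0 : 0 < beta) (beta_le : beta <= 3 - gamma)
    (H_growth : forall x p, closure O x -> H x p <= C * (1 + enorm p `^ beta))
    (omega : R -> R) (omega_cont : {within `[0, +oo[, continuous omega})
    (omega_ge0 : forall t, 0 <= t -> 0 <= omega t) (omega0 : omega 0 = 0)
    (H_modulus : forall x y p, closure O x -> closure O y ->
       `|H x p - H y p| <= omega (enorm (x - y)) * (1 + enorm p `^ beta))
    (u v : 'rV[R]_d -> R)
    (u_bnd : [bounded u x | x in closure O]) (u_usc : usc_on (closure O) u)
    (u_sub : viscosity_subsolution gamma
               (fun x r p => H x p + c x * F r - h1 x) O u)
    (v_bnd : [bounded v x | x in closure O]) (v_lsc : lsc_on (closure O) v)
    (v_super : viscosity_supersolution gamma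
                 (fun x r p => H x p + c x * F r - h2 x) O v)
    (uv_boundary : forall x, boundary O x -> u x <= v x)
    (ab : (forall x, closure O x -> c x < 0 /\ h2 x <= h1 x) \/
          (forall x, closure O x -> c x <= 0 /\ h2 x < h1 x)) :
  forall x, closure O x -> u x <= v x.
Proof.
move=> xs Kxs; rewrite leNgt; apply/negP => vu.
have [oO _ _] := domO.
have OK : O `<=` closure O := @subset_closure _ O.
have cK : compact (closure O).
  have [B [_ /(_ (B + 1))]] := bndO; rewrite ltrDl ltr01 => /(_ isT) hB.
  apply: (compact_in_ball (x0 := 0) (r := d%:R * (B + 1))); first exact: closed_closure.
  have cl : closed [set x : 'rV[R]_d | enorm (x - 0) <= d%:R * (B + 1)].
    by apply: closed_sublevel; exact: continuous_enorm_sub.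
  move=> x Kx.
  suff : closure [set x : 'rV[R]_d | enorm (x - 0) <= d%:R * (B + 1)] x.
    by rewrite -(iffLR (closure_id _) cl).
  apply: closure_subset Kx => y /hB yB /=; rewrite subr0.
  by apply: le_trans (enorm_le_norm _) _; rewrite ler_wpM2l.
have [M [M0 uM vM]] : exists M, [/\ 0 <= M, forall x, closure O x -> `|u x| <= M
    & forall x, closure O x -> `|v x| <= M].
  have [M1 [_ /(_ (M1 + 1))]] := u_bnd; rewrite ltrDl ltr01 => /(_ isT) h1M.
  have [M2 [_ /(_ (M2 + 1))]] := v_bnd; rewrite ltrDl ltr01 => /(_ isT) h2M.
  exists (`|M1 + 1| + `|M2 + 1|); split; first by rewrite addr_ge0.
    move=> x /h1M /= /le_trans; apply.
    by have := ler_norm (M1 + 1); have := normr_ge0 (M2 + 1); clear; lra.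
  move=> x /h2M /= /le_trans; apply.
  by have := ler_norm (M2 + 1); have := normr_ge0 (M1 + 1); clear; lra.
have v_usc : usc_on (closure O) (fun x => - v x).
  by rewrite /usc_on (_ : (fun _ => _) = v)//; apply/funext => x; rewrite opprK.
pose m := u xs - v xs; have m0 : 0 < m by rewrite subr_gt0.
have c0 x : closure O x -> c x <= 0.
  by move=> Kx; case: ab => /(_ x Kx)[]// /ltW.
have [t t0 ht] := strict_separation cK oO m0 M0 c_cont h1_cont h2_cont F_cont
  F_incr u_usc v_usc vM uv_boundary ab.
have qu := viscosity_subsolution_quad u_sub.
have qv := viscosity_supersolution_quad v_super.
have [Bc Bc0 hBc] := within_continuous_bounded cK c_cont.
have [Bh Bh0 hBh] := within_continuous_bounded cK h1_cont.
have Fw (s r : R) : s <= r -> F s <= F r.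
  by rewrite le_eqVlt => /orP[/eqP->//|/F_incr/ltW].
pose BF := `|F M| + `|F (- M)|.
have hBF x : closure O x -> `|F (u x)| <= BF.
  move=> /uM; rewrite ler_norml => /andP[/Fw f1 /Fw f2]; rewrite ler_norml /BF.
  have := ler_norm (F M); have := ler_norm (- F (- M)); rewrite normrN.
  have := normr_ge0 (F M); have := normr_ge0 (F (- M)).
  by move: f1 f2; clear; lra.
have BF0 : 0 <= BF by rewrite addr_ge0.
pose Mg := 2 * `|C| + Bc * BF + Bh + 1.
have Mg0 : 0 < Mg.
  by rewrite ltr_wpDl// !addr_ge0// mulr_ge0.
(* The growth exponent [beta <= 3 - gamma] enters here: for [1 <= enorm b] every term is at most a
   constant times [enorm b] to the power [3 - gamma]. *)
have hGL x b : closure O x -> 1 <= enorm b ->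
    H x b + c x * F (u x) - h1 x <= Mg * (enorm b `^ (- gamma) * enorm b ^+ 3).
  move=> Kx b1.
  have -> : enorm b `^ (- gamma) * enorm b ^+ 3 = enorm b `^ (3 - gamma).
    rewrite -powR_mulrn ?enorm_ge0// -powRD; first by rewrite addrC.
    by apply/implyP => _; rewrite gt_eqF// (lt_le_trans _ b1).
  have P1 : 1 <= enorm b `^ (3 - gamma).
    by rewrite -[leLHS](powRr0 (enorm b)) ler_powR//; move: gamma_le2; clear; lra.
  have P2 : enorm b `^ beta <= enorm b `^ (3 - gamma) by rewrite ler_powR.
  move: (enorm b `^ (3 - gamma)) P1 P2 => P P1 P2.
  have q0 : 0 <= enorm b `^ beta by rewrite powR_ge0.
  have E1 : H x b <= 2 * `|C| * P.
    apply: le_trans (H_growth x b Kx) _.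
    apply: (@le_trans _ _ (`|C| * (1 + enorm b `^ beta))).
      by rewrite ler_wpM2r ?ler_norm// addr_ge0.
    rewrite (mulrC 2) -mulrA ler_wpM2l//; move: P1 P2; clear; lra.
  have E2 : c x * F (u x) <= Bc * BF * P.
    apply: le_trans (ler_norm _) _; rewrite normrM.
    apply: (@le_trans _ _ (Bc * BF)); first by rewrite ler_pM ?hBc ?hBF.
    by rewrite ler_peMr// mulr_ge0.
  have E3 : - h1 x <= Bh * P.
    apply: le_trans (ler_norm _) _; rewrite normrN.
    by apply: le_trans (hBh x Kx) _; rewrite ler_peMr.
  by rewrite /Mg; move: E1 E2 E3 P1; clear; lra.
pose rho := Num.min (t / 2) (1 / (4 * Mg)).
have rho0 : 0 < rho by rewrite lt_min !divr_gt0// mulr_gt0.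
have rhot : rho <= t / 2 by rewrite ge_min lexx.
have Mrho : Mg * rho <= 1 / 4.
  have : rho <= 1 / (4 * Mg) by rewrite ge_min lexx orbT.
  by rewrite ler_pdivlMr ?mulr_gt0//; clear; lra.
clearbody rho.
(* The barrier is used with [S = 2 * M], a bound for the oscillation of [u]. *)
pose A := Num.max 2 (2 * (2 * M) / rho).
have A2 : 2 <= A by rewrite le_max lexx.
have AS : 2 * (2 * M) <= A * rho by rewrite -ler_pdivrMr// le_max lexx orbT.
clearbody A; have ballK (x : 'rV[R]_d) r y : (forall z, enorm (z - x) <= r -> O z) ->
  enorm (y - x) <= r -> closure O y by move=> h /h /OK.
have lip y : (forall z, enorm (z - y) <= rho -> O z) ->
    forall x, enorm (x - y) <= rho -> u x <= u y + A * enorm (x - y).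
  move=> hO; apply: (quad_sub_lipschitz qu rho0 hO _ Mg0 Mrho (S := 2 * M)) => //.
  - apply: eusc_subset (usc_on_enorm u_usc) => z; exact: ballK hO.
  - by move=> x b /(ballK _ _ _ hO); exact: hGL.
  - move=> x /(ballK _ _ _ hO) /uM.
    have /uM : closure O y by apply: (ballK _ _ _ hO); rewrite subrr enorm0 ltW.
    by rewrite !ler_norml => /andP[+ +] /andP[+ +]; clear; lra.
(* [4 * A] will bound the norm [4 * k * r ^+ 3] of the penalty gradient, whatever [k] is. *)
have [r1 r10 hr1] : exists2 r, 0 < r & forall s, 0 <= s -> s < r ->
    omega s * (1 + (4 * A) `^ beta) < t / 2.
  have P0 : 0 < 1 + (4 * A) `^ beta by rewrite ltr_wpDr// powR_ge0.
  have e0 : 0 < t / 2 / (1 + (4 * A) `^ beta) by rewrite !divr_gt0.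
  move/subspace_continuousP: omega_cont => /(_ 0); rewrite /= in_itv/= lexx.
  move=> /(_ isT)/cvgrPdist_lt/(_ _ e0); rewrite /within/=.
  move=> /nbhs_ballP[r /= r0 hr]; exists r => // s s0 sr.
  have := hr s; rewrite /ball/= sub0r normrN ger0_norm// in_itv/= s0.
  rewrite /from_subspace omega0 sub0r normrN ger0_norm ?omega_ge0// => /(_ sr isT).
  by rewrite ltr_pdivlMr.
pose r0 := Num.min r1 rho.
have r00 : 0 < r0 by rewrite lt_min r10.
(* At the maximum [k * r ^+ 4 < 2 * M + 1 = k * r0 ^+ 4], which forces [r < r0]. *)
pose k := (2 * M + 1) / r0 ^+ 4.
have k0 : 0 < k by rewrite divr_gt0 ?exprn_gt0// ltr_wpDl// mulr_ge0.
have kE : k * r0 ^+ 4 = 2 * M + 1 by rewrite divfK// gt_eqF// exprn_gt0.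
clearbody k; have [x [y [Kx Ky mx]]] := doubling_max k cK Kxs u_usc v_usc.
have uvm : m <= u x - v y - k * dot (x - y) (x - y) ^+ 2.
  by have := mx xs xs Kxs Kxs; rewrite subrr dot0l expr0n/= mulr0 subr0.
pose r := enorm (x - y); have rge0 : 0 <= r := enorm_ge0 _.
have dotr : dot (x - y) (x - y) = r ^+ 2 by rewrite enorm_sqr.
have rr0 : r < r0.
  have : k * r ^+ 4 < k * r0 ^+ 4.
    rewrite kE; move: uvm; rewrite dotr -exprM.
    have := uM x Kx; have := vM y Ky; rewrite !ler_norml.
    by move: m0 => + /andP[+ +] /andP[+ +]; clear; lra.
  by rewrite ltr_pM2l// ltr_pXn2r// nnegrE// ltW.
have [rr1 rrho] : r < r1 /\ r < rho by move: rr0; rewrite lt_min => /andP[].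
have mxy : m <= u x - v y.
  apply: le_trans uvm _; rewrite gerBl mulr_ge0 ?(ltW k0)//.
  by rewrite dotr -exprM exprn_ge0.
have [Obx sep] : (forall z, enorm (z - x) < t -> O z) /\
    (c x * F (u x) - h1 x) - (c y * F (v y) - h2 y) <= - t.
  by apply: ht => //; move: rrho rhot t0; rewrite -/r; clear; lra.
have Oy z : enorm (z - y) <= rho -> O z.
  move=> zy; apply: Obx; rewrite -(subrK y z) -addrA.
  apply: le_lt_trans (enormD _ _) _; rewrite (enormBC y) -/r.
  by move: zy rrho rhot; clear; lra.
have Ox z : enorm (z - x) <= rho -> O z.
  by move=> zx; apply: Obx; move: zx rhot t0; clear; lra.
have Oxx : O x by apply: Ox; rewrite subrr enorm0 ltW.
have Oyy : O y by apply: Oy; rewrite subrr enorm0 ltW.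
have [xy0|xy0] := eqVneq (x - y) 0.
  have /eqP := xy0; rewrite subr_eq0 => /eqP exy.
  (* A quartic lies below every quadratic near its centre, as the critical clause of [quad_sub]
     requires. Both equations then hold at [x] with gradient 0, so [H x 0] cancels. *)
  have small eta : 0 < eta -> exists2 s, 0 < s & forall z, enorm (z - x) < s ->
      closure O z /\ k * dot (z - x) (z - x) ^+ 2 <= eta / 2 * dot (z - x) (z - x).
    move=> eta0; pose s := Num.min 1 (eta / (2 * k)).
    have s0 : 0 < s by rewrite lt_min ltr01 divr_gt0// mulr_gt0.
    exists (Num.min rho s); first by rewrite lt_min rho0 s0.
    move=> z; rewrite lt_min => /andP[zr zs]; split; first exact/OK/Ox/ltW.
    rewrite expr2 mulrA ler_wpM2r ?dot_ge0// -enorm_sqr.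
    have zs2 : enorm (z - x) ^+ 2 <= s.
      have s1 : s <= 1 by rewrite ge_min lexx.
      have z0 := enorm_ge0 (z - x).
      by move: zs s1 z0 s0; move: (enorm _) => q; clear; nra.
    have : s <= eta / (2 * k) by rewrite ge_min lexx orbT.
    rewrite ler_pdivlMr ?mulr_gt0//.
    have : k * enorm (z - x) ^+ 2 <= k * s by rewrite ler_wpM2l// ltW.
    by clear; lra.
  have hx : 0 <= H x 0 + c x * F (u x) - h1 x.
    apply: (qu.2 x Oxx) => eta /small[s s0 hs]; exists s => // z /hs[Kz kz].
    have := mx z y Kz Ky; rewrite xy0 dot0l -exy expr0n/= mulr0 subr0.
    rewrite /quad dot0l expr0n/= mulr0 !addr0.
    by move: kz; clear; lra.
  have : 0 <= - (H x (- 0) + c x * F (- - v x) - h2 x).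
    apply: (qv.2 x Oxx) => eta /small[s s0 hs]; exists s => // z /hs[Kz kz].
    have := mx x z Kx Kz; rewrite xy0 dot0l -exy expr0n/= mulr0 subr0.
    rewrite /quad dot0l expr0n/= mulr0 !addr0.
    have -> : dot (x - z) (x - z) = dot (z - x) (z - x).
      by rewrite -(opprB z x) dotNl dotNr opprK.
    by move: kz; clear; lra.
  by move: sep hx t0; rewrite oppr0 opprK -exy; clear; lra.
have r_gt0 : 0 < r by rewrite enorm_gt0.
(* Comparison with the pair [(y, y)] gives [k * r ^+ 4 <= u x - u y], and the Lipschitz estimate
   around [y] bounds this by [A * r]. *)
have kr : k * r ^+ 3 <= A.
  have := mx y y Ky Ky; rewrite subrr dot0l dotr expr0n/= mulr0 subr0 -exprM.
  have /(lip y Oy) : enorm (x - y) <= rho by rewrite ltW.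
  rewrite -/r => h1' h2'; rewrite -(ler_pM2r r_gt0).
  by move: h1' h2'; clear; lra.
pose e := r^-1 *: (x - y).
have eE : x - y = r *: e by rewrite scalerA divff ?scale1r// gt_eqF.
have e1 : dot e e = 1.
  by rewrite dotZl dotZr dotr; field; rewrite gt_eqF.
clearbody e.
pose tau := 4 * k * r ^+ 3.
have tau0 : 0 < tau by rewrite !mulr_gt0// exprn_gt0.
(* The bound [1 / 2] gives [enorm (w - w') <= 1], so the quartic remainder of the penalty is
   controlled by its quadratic part. *)
pose rho' := Num.min rho (1 / 2).
have rho'0 : 0 < rho' by rewrite lt_min rho0 divr_gt0.
have rho'1 : rho' <= rho by rewrite ge_min lexx.
have rho'2 : rho' <= 1 / 2 by rewrite ge_min lexx orbT.
have Ox' z : enorm (z - x) <= rho' -> O z by move=> h; apply: Ox; apply: le_trans h _.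
have Oy' z : enorm (z - y) <= rho' -> O z by move=> h; apply: Oy; apply: le_trans h _.
have K1 : 0 <= k * (10 * r ^+ 2 + 2).
  by rewrite mulr_ge0 ?(ltW k0)// addr_ge0// mulr_ge0// exprn_ge0.
have coupling w w' : enorm w <= rho' -> enorm w' <= rho' ->
    u (x + w) + - v (y + w') <= u x + - v y + dot (tau *: e) (w - w') +
      k * (10 * r ^+ 2 + 2) * dot (w - w') (w - w').
  move=> hw hw'.
  have Kw : closure O (x + w) by apply/OK/Ox'; rewrite addrC addKr.
  have Kw' : closure O (y + w') by apply/OK/Oy'; rewrite addrC addKr.
  have := mx _ _ Kw Kw'; rewrite dotr.
  have -> : x + w - (y + w') = r *: e + (w - w').
    by rewrite -eE opprD addrACA.
  have q1 : dot (w - w') (w - w') <= 1.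
    have : enorm (w - w') <= 1.
      apply: le_trans (enormD _ _) _; rewrite enormN.
      by move: hw hw' rho'2; clear; lra.
    by rewrite ler_enorm ?expr1n.
  have CS : dot e (w - w') ^+ 2 <= dot (w - w') (w - w').
    by have := CauchySchwarz_dot e (w - w'); rewrite e1 mul1r.
  have q0 := dot_ge0 (w - w').
  move: q1 CS q0; move: (w - w') => z q1 CS q0.
  rewrite !dotDl !dotDr !dotZl !dotZr e1 (dotC z e) mulr1.
  set q := dot z z in q1 CS q0 *; set a := dot e z in CS *.
  (* In the expansion [4 r a q <= 4 r^2 a^2 + q^2]; with [a^2 <= q] and [q^2 <= q] the terms beyond
     first order add up to at most [(10 r^2 + 2) q]. *)
  have E : (r * r + r * a + (r * a + q)) ^+ 2 <=
      (r ^+ 2) ^+ 2 + 4 * r ^+ 3 * a + (10 * r ^+ 2 + 2) * q.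
    have E1 : r ^+ 2 * a ^+ 2 <= r ^+ 2 * q by rewrite ler_wpM2l// exprn_ge0.
    have E2 : q ^+ 2 <= q by rewrite expr2 ler_piMl.
    have E3 : 0 <= (2 * r * a - q) ^+ 2 by rewrite sqr_ge0.
    by move: E1 E2 E3; clear; nra.
  have : k * (r * r + r * a + (r * a + q)) ^+ 2 <=
      k * ((r ^+ 2) ^+ 2 + 4 * r ^+ 3 * a + (10 * r ^+ 2 + 2) * q).
    by rewrite ler_wpM2l// ltW.
  by rewrite /tau; clear; lra.
have Hcont (x0 p : 'rV[R]_d) (eps : R) : closure O x0 -> 0 < eps ->
    exists2 s, 0 < s & forall z b, closure O z -> enorm (z - x0) < s ->
      enorm (b - p) < s -> `|H z b - H x0 p| < eps.
  move=> Kx0 eps0.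
  move/subspace_continuousP: H_cont => /(_ (x0, p)).
  move=> /(_ (conj Kx0 I))/cvgrPdist_lt/(_ _ eps0); rewrite /within/=.
  case=> -[S1 S2] /= [/near_enormP[s1 s10 hs1] /near_enormP[s2 s20 hs2]] hS.
  exists (Num.min s1 s2); first by rewrite lt_min s10.
  move=> z b Kz; rewrite !lt_min => /andP[/hs1 z1 _] /andP[_ /hs2 b2].
  by rewrite distrC; apply: (hS (z, b)).
have pn : enorm (tau *: e) = tau.
  rewrite enormZ gtr0_norm//; suff -> : enorm e = 1 by rewrite mulr1.
  by apply/eqP; rewrite -(@eqrXn2 _ 2)// ?enorm_ge0// enorm_sqr e1 expr1n.
have subK (x0 : 'rV[R]_d) : (forall z, enorm (z - x0) <= rho' -> O z) ->
  [set z | enorm (z - x0) <= rho'] `<=` closure O by move=> h z /h/OK.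
have restrict G (w : 'rV[R]_d -> R) x0 p : (forall z, enorm (z - x0) <= rho' -> O z) ->
    usc_along G (closure O) w x0 p ->
    usc_along G [set z | enorm (z - x0) <= rho'] w x0 p.
  move=> hO hG eps eps0; have [s s0 hs] := hG _ eps0.
  by exists s => // z b /(subK _ hO); exact: hs.
have := @quad_sub_doubling _ _ _ _ _ O u (fun z => - v z) x y (tau *: e) e tau rho'
  (k * (10 * r ^+ 2 + 2)) qu qv rho'0 Ox' Oy' (eusc_subset (subK _ Ox')
  (usc_on_enorm u_usc)) (eusc_subset (subK _ Oy') (usc_on_enorm v_usc)) e1 erefl _ K1
  coupling.
rewrite gt_eqF// => /(_ isT) dbl.
have : 0 <= H x (tau *: e) + c x * F (u x) - h1 x +
    - (H y (- - (tau *: e)) + c y * F (- - v y) - h2 y).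
  apply: dbl; apply: restrict => //.
    apply: usc_along_hamiltonian => //.
    - by move=> eps eps0; exact: Hcont.
    - exact: within_continuous_enorm.
    - exact: within_continuous_enorm.
    - exact: F_cont.
  (* The reflected equation has the same form, with [- F (- s)] still increasing and the same
     coefficient [c <= 0], so one semicontinuity lemma serves both. *)
  have -> : (fun z (s : R) (q : 'rV[R]_d) => - (H z (- q) + c z * F (- s) - h2 z)) =
      (fun z (s : R) (q : 'rV[R]_d) => - H z (- q) + c z * (- F (- s)) - (- h2 z)).
    by apply/funext => z; apply/funext => s; apply/funext => q; ring.
  apply: usc_along_hamiltonian => //.
  - move=> eps eps0; have [s s0 hs] := Hcont y (- - (tau *: e)) eps Ky eps0.
    exists s => // z b Kz zs bs; rewrite -opprD normrN; apply: hs => //.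
    by rewrite -opprD enormN.
  - exact: within_continuous_enorm.
  - move=> eps eps0; have [s s0 hs] := within_continuous_enorm h2_cont Ky eps0.
    by exists s => // z Kz zs; rewrite -opprD normrN; exact: hs.
  - by move=> s1 s2 s12; rewrite ltrN2 F_incr// ltrN2.
  - apply: continuousN; apply: (@continuous_comp _ _ _ -%R F); last exact: F_cont.
    exact: opp_continuous.
rewrite !opprK.
(* The difference of the two [H] terms is below [t / 2], while the zero-order terms contribute at
   most [- t]. *)
have := H_modulus x y (tau *: e) Kx Ky; rewrite pn -/r ler_norml => /andP[_ Hm].
have : omega r * (1 + tau `^ beta) <= omega r * (1 + (4 * A) `^ beta).
  rewrite ler_wpM2l ?omega_ge0// lerD2l ge0_ler_powR ?nnegrE ?(ltW tau0) ?(ltW beta_gt0)//.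
    by rewrite mulr_ge0//; move: A2; clear; lra.
  by rewrite /tau -mulrA ler_wpM2l.
have := hr1 r rge0 rr1.
by move: sep Hm t0; clear; lra.
Qed.
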